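(* Let $M\models T_+$ and suppose $T_0\subseteq T$. Assume that $T_0$ has, in addition to $\perp\!\!\!\perp^0$, an independence relation $\perp\!\!\!\perp^1$ such that $A\perp\!\!\!\perp^0_M B$ implies $A\perp\!\!\!\perp^1_M B$ for all small $A,B$; that $T$ is derivation-like with respect to $(T_0,\perp\!\!\!\perp^1)$; and that $\perp\!\!\!\perp^0_M$ satisfies monotonicity, symmetry, and extension. If $\perp\!\!\!\perp^0$ satisfies the independence theorem over $M$, then so does the relation $\perp\!\!\!\perp^+$ defined on small subsets of $\mathcal U_+$ by $A\perp\!\!\!\perp^+_C B\iff\operatorname{acl}_+(AC)\perp\!\!\!\perp^0_{\operatorname{acl}_+(C)}\operatorname{acl}_+(BC)$.
   Context: Theories are closed under deduction. $\mathcal L_0\subseteq\mathcal L$ are first-order (possibly many-sorted) languages. $T_0$ is a complete, model complete $\mathcal L_0$-theory with monster model $\mathcal U_0$, and $\perp\!\!\!\perp^0$ is an automorphism-invariant ternary relation on small subsets of $\mathcal U_0$; $\operatorname{acl}_0$ is algebraic closure in $\mathcal U_0$ in $\mathcal L_0$. $T$ is an $\mathcal L$-theory with $T_0^\forall\subseteq T$. $M\leq_{\mathcal L}N$ means $M$ is an $\mathcal L$-substructure of $N$; $\langle X\rangle_{\mathcal L}$ is the generated $\mathcal L$-substructure. Definition: for an invariant ternary relation $\perp\!\!\!\perp$ on small subsets of $\mathcal U_0$, $T$ is derivation-like with respect to $(T_0,\perp\!\!\!\perp)$ if whenever $A,B,C\models T^\forall$ with $C$ a common $\mathcal L$-substructure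 of $A$ and $B$, $A,B\leq_{\mathcal L_0}\mathcal U_0$, $\operatorname{acl}_0(C)\cap A=\operatorname{acl}_0(C)\cap B=C$, and $A\perp\!\!\!\perp_C B$, then (i) there is $N\models T$ with $N\leq_{\mathcal L_0}\mathcal U_0$ and $A,B\leq_{\mathcal L}N$; and (ii) for every such $N$ and every $\mathcal L_0$-structure $D$ with $\langle A,B\rangle_{\mathcal L_0}\leq_{\mathcal L_0}D\leq_{\mathcal L_0}\operatorname{acl}_0(A,B)\cap N$, we have $D\leq_{\mathcal L}N$, and this $\mathcal L$-structure on $D$ is the unique one expanding its $\mathcal L_0$-structure, making it a model of $T^\forall$, and extending the $\mathcal L$-structures of $A$ and $B$. Standing assumptions: $T$ is derivation-like with respect to $(T_0,\perp\!\!\!\perp^0)$; $T$ has a model companion $T_+$ with $T\subseteq T_+$; $\mathcal U_+$ is a monster model of a completion of $T_+$ with $\mathcal U_+\leq_{\mathcal L_0}\mathcal U_0$; $\operatorname{acl}_+$ is algebraic closure in $\mathcal U_+$ in $\mathcal L$; $T_0$ has quantifier elimination in $\mathcal L_0$ (a standing assumption of the paper). An independence relation is an automorphism-invariant ternary relation satisfying normality, monotonicity, base monotonicity, transitivity, symmetry, full existence, finite character and local character. For $\perp\!\!\!\perp_M$: monotonicity: $A\perp\!\!\!\perp_M BD\Rightarrow A\perp\!\!\!\perp_M B$; symmetry: $A\perp\!\!\!\perp_M B\Rightarrow B\perp\!\!\!\perp_M A$; extension: if $A\perp\!\!\!\perp_M B$ then for every $D$ there is $A'\equiv_{BM}A$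 with $A'\perp\!\!\!\perp_M BD$. Independence theorem over $M$: if $A_1\perp\!\!\!\perp_M A_2$, $a_1\perp\!\!\!\perp_M A_1$, $a_2\perp\!\!\!\perp_M A_2$ and $a_1\equiv_M a_2$, then there is $a$ realising $\operatorname{tp}(a_1/MA_1)\cup\operatorname{tp}(a_2/MA_2)$ with $a\perp\!\!\!\perp_M A_1A_2$ (types in $T_0$ for $\perp\!\!\!\perp^0$, in $T_+$ for $\perp\!\!\!\perp^+$). *)

(* Defs.v *)
(* Conventions.  Languages are many-sorted; a language, its sublanguages and all
   structures share one type S of sorts, and sorts may be empty in a structure.
   Formulas are scoped by an S-sorted family X of free variables, of any size: a
   sentence has none, and a formula with parameters from a set B is a formula
   whose variables include the elements of B, interpreted by themselves.
   Deduction is semantic consequence. *)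
From mathcomp Require Import ssreflect ssrfun ssrbool fintype.
From mathcomp Require Import classical_sets cardinality.

Set Implicit Arguments.
Unset Strict Implicit.
Unset Printing Implicit Defensive.

Local Open Scope classical_set_scope.
Local Open Scope card_scope.

Definition card_lt (T U : Type) (A : set T) (B : set U) : Prop :=
  (A #<= B) /\ ~ (B #<= A).

(* The type K stands for its cardinal kappa: small means of size < kappa. *)
Definition small (K T : Type) (A : set T) : Prop := card_lt A [set: K].

(** * Sorted families *)

Definition el (S : Type) (X : S -> Type) : Type := {s : S & X s}.

Definition fhom (S : Type) (X Y : S -> Type) : Type := forall s, X s -> Y s.

Definition elmap (S : Type) (X Y : S -> Type) (h : fhom X Y) (e : el X) : el Y :=
  existT Y (projT1 e) (h (projT1 e) (projT2 e)).

Definition fcomp (S : Type) (X Y Z : S -> Type) (g : fhom Y Z) (f : fhom X Y) :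
  fhom X Z := fun s x => g s (f s x).

Definition subfam (S : Type) (X : S -> Type) (A : set (el X)) : S -> Type :=
  fun s => {x : X s | A (existT X s x)}.

Definition subfam_inc (S : Type) (X : S -> Type) (A : set (el X)) :
  fhom (subfam A) X := fun s x => proj1_sig x.

Definition join (S : Type) (X Y : S -> Type) : S -> Type :=
  fun s => (X s + Y s)%type.

Definition vjoin (S : Type) (X Y U : S -> Type) (v : fhom X U) (w : fhom Y U) :
  fhom (join X Y) U :=
  fun s z => match z with inl x => v s x | inr y => w s y end.

Definition nofam (S : Type) : S -> Type := fun=> Empty_set.

Definition novar (S : Type) (U : S -> Type) : fhom (@nofam S) U :=
  fun s x => match x with end.

(* The family X with one more element, of sort s. *)
Inductive ext (S : Type) (X : S -> Type) (s : S) : S -> Type :=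
| Old t : X t -> ext X s t
| New : ext X s s.

Definition vext (S : Type) (X U : S -> Type) (v : fhom X U) (s : S) (a : U s) :
  fhom (ext X s) U :=
  fun t z => match z in ext _ _ t return U t with
             | Old t x => v t x
             | New => a
             end.

(** * Languages and formulas *)

Record language (S : Type) := Language {
  fsym : Type;
  far : fsym -> nat;
  fdom : forall f : fsym, 'I_(far f) -> S;
  fcod : fsym -> S;
  rsym : Type;
  rar : rsym -> nat;
  rdom : forall r : rsym, 'I_(rar r) -> S
}.

Inductive term (S : Type) (L : language S) (X : S -> Type) : S -> Type :=
| Var s : X s -> term L X s
| App (f : fsym L) : (forall i, term L X (@fdom S L f i)) -> term L X (fcod f).

Inductive formula (S : Type) (L : language S) (X : S -> Type) : Type :=
| Bot : formula L X
| Eql s : term L X s -> term L X s -> formula L X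
| Rel (r : rsym L) : (forall i, term L X (@rdom S L r i)) -> formula L X
| Imp : formula L X -> formula L X -> formula L X
| All s : formula L (ext X s) -> formula L X.
Arguments Bot {S L X}.

Definition Not (S : Type) (L : language S) (X : S -> Type) (p : formula L X) :=
  Imp p Bot.

Fixpoint qf (S : Type) (L : language S) (X : S -> Type) (p : formula L X) : Prop :=
  match p with
  | Bot | Eql _ _ _ | Rel _ _ => True
  | Imp p q => qf p /\ qf q
  | All _ _ => False
  end.

Fixpoint universal (S : Type) (L : language S) (X : S -> Type)
    (p : formula L X) : Prop :=
  match p with
  | All _ p => universal p
  | p => qf p
  end.

Definition sentence (S : Type) (L : language S) : Type := formula L (@nofam S).

Definition theory (S : Type) (L : language S) : Type := set (sentence L).

(** * Structures *)

Record structure (S : Type) (L : language S) := Structure {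
  carrier :> S -> Type;
  fint : forall f : fsym L,
    (forall i, carrier (@fdom S L f i)) -> carrier (fcod f);
  rint : forall r : rsym L, (forall i, carrier (@rdom S L r i)) -> Prop
}.

Fixpoint tval (S : Type) (L : language S) (U : structure L) (X : S -> Type)
    (v : fhom X U) (s : S) (t : term L X s) : U s :=
  match t in term _ _ s return U s with
  | Var s x => v s x
  | App f ts => fint (fun i => tval v (ts i))
  end.

Fixpoint sat (S : Type) (L : language S) (U : structure L) (X : S -> Type)
    (p : formula L X) : fhom X U -> Prop :=
  match p with
  | Bot => fun=> False
  | Eql s t u => fun v => tval v t = tval v u
  | Rel r ts => fun v => rint (fun i => tval v (ts i))
  | Imp p q => fun v => sat p v -> sat q v
  | All s p => fun v => forall a : U s, sat p (vext v a)
  end.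

Definition holds (S : Type) (L : language S) (U : structure L) (p : sentence L) :=
  sat p (@novar S U).

Definition models (S : Type) (L : language S) (U : structure L) (T : theory L) :=
  forall p, T p -> holds U p.

Definition closed_subset (S : Type) (L : language S) (U : structure L)
    (P : set (el U)) : Prop :=
  forall (f : fsym L) (a : forall i, U (@fdom S L f i)),
    (forall i, P (existT U _ (a i))) -> P (existT U _ (fint a)).

Definition generated (S : Type) (L : language S) (U : structure L)
    (A : set (el U)) : set (el U) := smallest (@closed_subset S L U) A.

Definition embedding (S : Type) (L : language S) (M N : structure L)
    (h : fhom M N) : Prop :=
  [/\ forall s (x y : M s), h s x = h s y -> x = y,
      forall (f : fsym L) (a : forall i, M (@fdom S L f i)),
        h _ (fint a) = fint (fun i => h _ (a i))
    & forall (r : rsym L) (a : forall i, M (@rdom S L r i)),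
        rint a <-> rint (fun i => h _ (a i))].

Definition elementary (S : Type) (L : language S) (M N : structure L)
    (h : fhom M N) : Prop :=
  forall (X : S -> Type) (p : formula L X) (v : fhom X M),
    sat p v <-> sat p (fcomp h v).

Definition automorphism (S : Type) (L : language S) (M : structure L)
    (h : fhom M M) : Prop :=
  embedding h /\ forall s (y : M s), exists x, h s x = y.

(** * Theories *)

Definition deductively_closed (S : Type) (L : language S) (T : theory L) : Prop :=
  forall p, (forall U : structure L, models U T -> holds U p) -> T p.

Definition complete_theory (S : Type) (L : language S) (T : theory L) : Prop :=
  (exists U : structure L, models U T) /\ forall p, T p \/ T (Not p).

Definition universal_part (S : Type) (L : language S) (T : theory L) : theory L :=
  [set p | T p /\ universal p].

Definition model_complete (S : Type) (L : language S) (T : theory L) : Prop :=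
  forall (M N : structure L) (h : fhom M N),
    models M T -> models N T -> embedding h -> elementary h.

Definition quantifier_elimination (S : Type) (L : language S) (T : theory L) :
  Prop :=
  forall (X : S -> Type) (p : formula L X), exists2 q : formula L X, qf q &
    forall (U : structure L) (v : fhom X U), models U T -> (sat p v <-> sat q v).

Definition model_companion (S : Type) (L : language S) (T Tc : theory L) : Prop :=
  [/\ model_complete Tc,
      forall M : structure L, models M T ->
        exists (N : structure L) (h : fhom M N), models N Tc /\ embedding h
    & forall M : structure L, models M Tc ->
        exists (N : structure L) (h : fhom M N), models N T /\ embedding h].

(** * Types, algebraic closure, monster models *)

(* A tuple of U indexed by X is a map X -> U, and [trange] is its set of entries. *)
Definition trange (S : Type) (X U : S -> Type) (a : fhom X U) : set (el U) :=
  range (elmap a).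

Definition tp (S : Type) (L : language S) (U : structure L) (B : set (el U))
    (X : S -> Type) (a : fhom X U) : set (formula L (join X (subfam B))) :=
  [set p | sat p (vjoin a (@subfam_inc S U B))].

Arguments tp {S L U} B {X} a _.

Definition realises (S : Type) (L : language S) (U : structure L)
    (B : set (el U)) (X : S -> Type) (p : set (formula L (join X (subfam B))))
    (a : fhom X U) : Prop := p `<=` tp B a.

Definition acl (S : Type) (L : language S) (U : structure L) (A : set (el U)) :
  set (el U) :=
  [set e | exists p : formula L (ext (subfam A) (projT1 e)),
    let phi := [set y : U (projT1 e) | sat p (vext (@subfam_inc S U A) y)] in
    phi (projT2 e) /\ finite_set phi].

Definition saturated (K S : Type) (L : language S) (U : structure L) : Prop :=
  forall (X : S -> Type) (B : set (el U))
    (p : set (formula L (join X (subfam B)))),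
    small K [set: el X] -> small K B ->
    (forall q, q `<=` p -> finite_set q -> exists a, realises q a) ->
    exists a, realises p a.

Definition strongly_homogeneous (K S : Type) (L : language S) (U : structure L) :
  Prop :=
  forall (X : S -> Type) (a b : fhom X U), small K [set: el X] ->
    tp set0 a = tp set0 b ->
    exists2 h : fhom U U, automorphism h & forall s x, h s (a s x) = b s x.

Definition monster (K S : Type) (L : language S) (T : theory L)
    (U : structure L) : Prop :=
  [/\ models U T, saturated K U & strongly_homogeneous K U].

(* kappa > |L| + aleph_0. *)
Definition large_for (K S : Type) (L : language S) : Prop :=
  [/\ small K [set: nat], small K [set: S], small K [set: fsym L]
    & small K [set: rsym L]].

(** * Ternary relations on small subsets *)

(* [R A C B] reads "A is independent from B over C"; only the values of R at
   small sets are ever used. *)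
Definition ternary (S : Type) (U : S -> Type) : Type :=
  set (el U) -> set (el U) -> set (el U) -> Prop.

Definition invariant (K S : Type) (L : language S) (U : structure L)
    (R : ternary U) : Prop :=
  forall (h : fhom U U) (A B C : set (el U)), automorphism h ->
    small K A -> small K B -> small K C ->
    (R A C B <-> R (elmap h @` A) (elmap h @` C) (elmap h @` B)).

Definition monotonicity_over (K S : Type) (U : S -> Type) (R : ternary U)
    (C : set (el U)) : Prop :=
  forall A B D, small K A -> small K B -> small K D ->
    R A C (B `|` D) -> R A C B.

Definition symmetry_over (K S : Type) (U : S -> Type) (R : ternary U)
    (C : set (el U)) : Prop :=
  forall A B, small K A -> small K B -> R A C B -> R B C A.

Definition extension_over (K S : Type) (L : language S) (U : structure L)
    (R : ternary U) (C : set (el U)) : Prop :=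
  forall (X : S -> Type) (a : fhom X U) (B D : set (el U)),
    small K [set: el X] -> small K B -> small K D -> R (trange a) C B ->
    exists2 a' : fhom X U, tp (B `|` C) a' = tp (B `|` C) a
      & R (trange a') C (B `|` D).

Record independence_relation (K S : Type) (L : language S) (U : structure L)
    (R : ternary U) : Prop := {
  ind_invariance : invariant K R;
  ind_normality : forall A B C, small K A -> small K B -> small K C ->
    R A C B -> R A C (B `|` C);
  ind_monotonicity : forall C, small K C -> monotonicity_over K R C;
  ind_base_monotonicity : forall A B C D,
    small K A -> small K B -> small K C -> small K D ->
    R A C (B `|` D) -> R A (C `|` D) B;
  ind_transitivity : forall A B C D,
    small K A -> small K B -> small K C -> small K D ->
    R A (C `|` B) D -> R B C D -> R (A `|` B) C D;
  ind_symmetry : forall C, small K C -> symmetry_over K R C;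
  ind_full_existence : forall (X : S -> Type) (a : fhom X U) (B C : set (el U)),
    small K [set: el X] -> small K B -> small K C ->
    exists2 a' : fhom X U, tp C a' = tp C a & R (trange a') C B;
  ind_finite_character : forall A B C, small K A -> small K B -> small K C ->
    (forall A0, A0 `<=` A -> finite_set A0 -> R A0 C B) -> R A C B;
  (* The cardinal bounding the size of the base depends only on A, and is
     represented by a small subset of K. *)
  ind_local_character : forall A, small K A ->
    exists2 l : set K, small K l &
      forall B, small K B ->
        exists C, [/\ C `<=` B, card_lt C l & R A C B]
}.

Definition independence_theorem (K S : Type) (L : language S) (U : structure L)
    (R : ternary U) (M : set (el U)) : Prop :=
  forall (X : S -> Type) (a1 a2 : fhom X U) (A1 A2 : set (el U)),
    small K [set: el X] -> small K A1 -> small K A2 ->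
    R A1 M A2 -> R (trange a1) M A1 -> R (trange a2) M A2 ->
    tp M a1 = tp M a2 ->
    exists a : fhom X U,
      [/\ realises (tp (M `|` A1) a1) a, realises (tp (M `|` A2) a2) a
        & R (trange a) M (A1 `|` A2)].

(** * Expansions of substructures *)

Record sublanguage (S : Type) (L : language S) := Sublanguage {
  sub_fsym : set (fsym L);
  sub_rsym : set (rsym L)
}.

Definition sublang (S : Type) (L : language S) (L0 : sublanguage L) : language S :=
  {| fsym := {f : fsym L | sub_fsym L0 f};
     far := fun f => far (proj1_sig f);
     fdom := fun f => @fdom S L (proj1_sig f);
     fcod := fun f => fcod (proj1_sig f);
     rsym := {r : rsym L | sub_rsym L0 r};
     rar := fun r => rar (proj1_sig r);
     rdom := fun r => @rdom S L (proj1_sig r) |}.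
Coercion sublang : sublanguage >-> language.

Fixpoint lift_term (S : Type) (L : language S) (L0 : sublanguage L)
    (X : S -> Type) (s : S) (t : term L0 X s) : term L X s :=
  match t in term _ _ s return term L X s with
  | Var s x => Var L x
  | App f ts => @App S L X (proj1_sig f) (fun i => lift_term (ts i))
  end.

Fixpoint lift_formula (S : Type) (L : language S) (L0 : sublanguage L) (X : S -> Type)
    (p : formula L0 X) : formula L X :=
  match p with
  | Bot => Bot
  | Eql s t u => Eql (lift_term t) (lift_term u)
  | Rel r ts => @Rel S L X (proj1_sig r) (fun i => lift_term (ts i))
  | Imp p q => Imp (lift_formula p) (lift_formula q)
  | All s p => All (lift_formula p)
  end.

Definition reduct (S : Type) (L : language S) (L0 : sublanguage L)
    (M : structure L) : structure L0 :=
  @Structure S L0 M (fun f => @fint S L M (proj1_sig f))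
    (fun r => @rint S L M (proj1_sig r)).

(* An L-structure A with A <=_{L0} U, given with its inclusion map into U. *)
Record lstr_in (S : Type) (L : language S) (L0 : sublanguage L)
    (U : structure L0) := LstrIn {
  ostr :> structure L;
  oinc : fhom ostr U;
  oincP : @embedding S L0 (reduct L0 ostr) U oinc
}.

Definition uset (S : Type) (L : language S) (L0 : sublanguage L)
    (U : structure L0) (A : lstr_in U) : set (el U) :=
  range (elmap (@oinc S L L0 U A)).

Definition push (S : Type) (L : language S) (L0 : sublanguage L)
    (U : structure L0) (A : lstr_in U) (P : set (el A)) : set (el U) :=
  elmap (@oinc S L L0 U A) @` P.

(* A <=_L B for A and B inside U; the inclusion of A into B is determined by
   the inclusions into U. *)
Definition subL (S : Type) (L : language S) (L0 : sublanguage L)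
    (U : structure L0) (A B : lstr_in U) : Prop :=
  exists2 h : fhom A B, embedding h & forall s (x : A s), oinc (h s x) = oinc x.

Definition derivation_like (K S : Type) (L : language S) (L0 : sublanguage L)
    (U : structure L0) (R : ternary U) (T : theory L) : Prop :=
  forall A B C : lstr_in U,
    models A (universal_part T) -> models B (universal_part T) ->
    models C (universal_part T) -> subL C A -> subL C B ->
    small K (uset A) -> small K (uset B) ->
    acl (uset C) `&` uset A = uset C -> acl (uset C) `&` uset B = uset C ->
    R (uset A) (uset C) (uset B) ->
    (exists N : lstr_in U, [/\ models N T, subL A N & subL B N]) /\
    (forall (N : lstr_in U) (D : set (el U)),
      models N T -> subL A N -> subL B N ->
      closed_subset D -> generated (uset A `|` uset B) `<=` D ->
      D `<=` acl (uset A `|` uset B) `&` uset N ->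
      let expands (E : lstr_in U) :=
        [/\ uset E = D, models E (universal_part T), subL A E & subL B E] in
      exists E : lstr_in U, [/\ expands E, subL E N
        & forall E' : lstr_in U, expands E' -> subL E' E /\ subL E E']).

Definition indep_plus (S : Type) (L : language S) (L0 : sublanguage L)
    (U : structure L0) (R : ternary U) (Up : lstr_in U) : ternary Up :=
  fun A C B => R (push (acl (A `|` C))) (push (acl C)) (push (acl (B `|` C))).

(* Main.v *)
(* Replace A_1, A_2, a_1, a_2 by their algebraic closures over M in T_+ and apply
   the independence theorem of R0 in U0, then extension: this gives b in U0 with
   the right T_0-types over A_1 and A_2 and independent from a small W <= U_+
   elementary containing A_1 and A_2.  Let S_i <= U_+ be small, elementary and
   contain a_i and A_i, and move S_1, S_2 by automorphisms of U0 sending a_i to b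
   and fixing A_i.  Since R0 implies R1 over M, the calculus of R1 lets one choose
   these automorphisms so that S_1 and S_2 are R1-independent over b.  As T is
   derivation-like for R1, they amalgamate in a model of T; let E be the
   L-structure induced there on acl_0(S_1 S_2).  By uniqueness E and W induce the
   same L-structure on C = acl_0(A_1 A_2), and after moving E over bC they are
   R1-independent over C, hence amalgamate in a model of T, which embeds in a
   model N of T_+.  By model completeness S_1, S_2 and W are elementary in N, and
   saturation of U_+ realises tp_N(b/W) by the required tuple.

   Working with elementary substructures instead of algebraic closures needs the
   downward Loewenheim-Skolem theorem for subsets of cardinality below kappa, and
   so Hessenberg's theorem Z * Z = Z for infinite Z. *)
From mathcomp Require Import ssreflect ssrfun ssrbool eqtype ssrnat seq choice.
From mathcomp Require Import fintype bigop.
From Stdlib Require List.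
From mathcomp Require Import boolp classical_sets functions cardinality.
Require Import Defs.

Set Implicit Arguments.
Unset Strict Implicit.
Unset Printing Implicit Defensive.

Local Open Scope classical_set_scope.
Local Open Scope card_scope.


(** * Cardinal arithmetic up to Hessenberg's theorem, and small sets *)

Lemma card_le_injP (T U : Type) (A : set T) (u : U) :
  A #<= [set: U] <->
  exists f : T -> U, forall x y, A x -> A y -> f x = f y -> x = y.
Proof.
split.
- move=> /card_leP/injfunPex[f _ finj].
  have mA x : A x -> x \in A by move=> ?; apply/mem_set.
  exists (fun x => if pselect (A x) is left ax then sval (f (exist _ x (mA x ax))) else u).
  move=> x y Ax Ay; case: pselect => // ax; case: pselect => // ay e.
  have /finj : f (exist _ x (mA x ax)) = f (exist _ y (mA y ay)).
    exact: val_inj.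
  by rewrite !inE => /(_ I I)[].
- move=> [f finj]; apply/card_leP/injfunPex.
  exists (fun x => exist _ (f (sval x)) (mem_set (I : [set: U] (f (sval x))))) => //.
  move=> [x xA] [y yA] _ _ [] /finj e; apply: val_inj; apply: e; exact: set_mem.
Qed.

(** Comparability of cardinals. Zorn gives a maximal graph [G] of a partial injection; if some [a]
    had no image and some [b] no preimage, the pair [(a, b)] could be added. *)
Lemma inj_total (A B : Type) :
  (exists f : A -> B, injective f) \/ (exists f : B -> A, injective f).
Proof.
pose P (G : set (A * B)) :=
  forall p q, G p -> G q -> (p.1 = q.1 <-> p.2 = q.2).
have [F FP Ftot|G [PG maxG]] := @Zorn_bigcup _ P.
  move=> p q [X FX Xp] [Y FY Yq].
  by case: (Ftot _ _ FX FY) => s; [apply: (FP _ FY) => //|apply: (FP _ FX) => //];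
    apply: s.
case: (pselect (forall a, exists b, G (a, b))) => [/choice[f fG]|/existsNP[a na]].
  by left; exists f => x y e; case: (PG _ _ (fG x) (fG y)) => /= _; apply.
case: (pselect (forall b, exists a, G (a, b))) => [/choice[f fG]|/existsNP[b nb]].
  by right; exists f => x y e; case: (PG _ _ (fG x) (fG y)) => /= H _; apply: H.
have /maxG [] : G `<` (G `|` [set (a, b)]).
  split; first by left.
  by move=> /(_ (a, b)) h; apply: na; exists b; apply: h; right.
move=> p q [Gp|->] [Gq|->] //=; first exact: PG.
- split=> e; exfalso; first by apply: na; exists p.2; rewrite -e -surjective_pairing.
  by apply: nb; exists p.1; rewrite -e -surjective_pairing.
- split=> e; exfalso; first by apply: na; exists q.2; rewrite e -surjective_pairing.
  by apply: nb; exists q.1; rewrite e -surjective_pairing.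
Qed.

Section Square.
Variable Z : Type.
Variable i : nat -> Z.
Hypothesis i_inj : injective i.

(* [G] is the graph of an injection [D * D -> D], where [D] is the domain of its
   diagonal. *)
Let dom (G : set (Z * Z * Z)) (x : Z) := exists z, G (x, x, z).
Let good (G : set (Z * Z * Z)) :=
  [/\ forall p q, G p -> G q -> (p.1 = q.1 <-> p.2 = q.2),
      forall x y z, G (x, y, z) -> [/\ dom G x, dom G y & dom G z]
    & forall x y, dom G x -> dom G y -> exists z, G (x, y, z)].

(** Hessenberg's theorem. Let [D] be the domain of a maximal graph and [E] its complement. If [E]
    injects into [D], then so does [Z], and the pairing on [D] gives one on [Z]. Otherwise [E]
    contains a copy of [D], and the pairing extends to the union of both copies, against
    maximality. *)
Lemma square_inj : exists f : Z * Z -> Z, injective f.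
Proof.
have [c c_inj] : exists c : nat * nat -> nat, injective c.
  by exists pickle; apply: (pcan_inj pickleK).
pose G0 : set (Z * Z * Z) := [set p | exists m n, p = (i m, i n, i (c (m, n)))].
have goodG0 : good G0.
  have d0 m : dom G0 (i m) by exists (i (c (m, m))), m, m.
  split.
  - move=> _ _ [m [n ->]] [m' [n' ->]] /=; split.
      by move=> [/i_inj -> /i_inj ->].
    by move=> /i_inj/c_inj[-> ->].
  - by move=> _ _ _ [m [n [-> -> ->]]].
  - by move=> x y [_ [m [_ [-> _ _]]]] [_ [n [_ [-> _ _]]]]; exists (i (c (m, n))), m, n.
(* Goodness is asked of the union with [G0], so that the empty chain is covered and the maximal
   graph contains the pairing of the points [i n]. *)
have [F FP Ftot|A [PA maxA]] := @Zorn_bigcup _ [set G | good (G `|` G0)].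
  have Fdir p q : (\bigcup_(X in F) X `|` G0) p -> (\bigcup_(X in F) X `|` G0) q ->
      exists G, [/\ good G, G `<=` \bigcup_(X in F) X `|` G0, G p & G q].
    have sub X : F X -> X `|` G0 `<=` \bigcup_(X in F) X `|` G0.
      by move=> FX r [Xr|?]; [left; exists X|right].
    move=> [[X FX Xp]|Gp] [[Y FY Yq]|Gq].
    - case: (Ftot _ _ FX FY) => s.
        by exists (Y `|` G0); split; [exact: FP|exact: sub|left; apply: s|left].
      by exists (X `|` G0); split; [exact: FP|exact: sub|left|left; apply: s].
    - by exists (X `|` G0); split; [exact: FP|exact: sub|left|right].
    - by exists (Y `|` G0); split; [exact: FP|exact: sub|right|left].
    - by exists G0; split => // r; right.
  split.
  - by move=> p q /Fdir H /H [G [[g _ _] _ Gp Gq]]; apply: g.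
  - move=> x y z /[dup] /Fdir H /H [G [[_ g _] sG Gp _]].
    by case: (g _ _ _ Gp) => -[a /sG ?] [b /sG ?] [d /sG ?]; split; [exists a|exists b|exists d].
  - move=> x y [a /Fdir H] [b /H [G [[_ _ g] sG Gp Gq]]].
    by case: (g x y); [exists a|exists b|move=> w /sG ?; exists w].
have {}maxA B : A `|` G0 `<=` B -> good B -> B `<=` A `|` G0.
  move=> sB gB; apply: contrapT => nB; apply: (maxA B).
    split; first by move=> x Ax; apply: sB; left.
    by move=> BA; apply: nB => x /BA; left.
  by change (good (B `|` G0)); rewrite (_ : _ `|` _ = B)//;
    apply/seteqP; split=> x; [case=> // ?; apply: sB; right|left].
have: G0 `<=` A `|` G0 by right.
move: PA maxA; rewrite /= /mkset; set G := A `|` G0; clearbody G => -[Gfun Gdom Gtot] maxG sG0.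
pose D := {x | dom G x}; pose E := {x | ~ dom G x}.
have valD_inj (u v : D) : sval u = sval v -> u = v.
  by case: u v => [u du] [v dv] /= e; apply: eq_exist.
have /choice[fD fDG] (p : D * D) : exists w : D, G (sval p.1, sval p.2, sval w).
  case: p => [[x dx] [y dy]] /=; have [z Gz] := Gtot _ _ dx dy.
  by have [_ _ dz] := Gdom _ _ _ Gz; exists (exist _ z dz).
have fD_inj : injective fD.
  move=> p q e; have [_] := Gfun _ _ (fDG p) (fDG q); rewrite /= e => /(_ erefl).
  by case: p q {e} => [p1 p2] [q1 q2] [] /valD_inj -> /valD_inj ->.
have domi n : dom G (i n) by exists (i (c (n, n))); apply: sG0; exists n, n.
pose t n : D := exist _ (i n) (domi n).
have [[g g_inj]|[g g_inj]] := inj_total D E; last first.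
  have [psi psi_inj] : exists psi : Z -> D, injective psi.
    exists (fun x => match pselect (dom G x) with
                     | left dx => fD (t 0, exist _ x dx)
                     | right nx => fD (t 1, g (exist _ x nx)) end).
    move=> x y; case: pselect => dx; case: pselect => dy /fD_inj[]//.
    - by move=> /i_inj.
    - by move=> /i_inj.
    - by move=> /g_inj[].
  exists (fun p => sval (fD (psi p.1, psi p.2))).
  by move=> [a b] [a' b'] /= /valD_inj/fD_inj[/psi_inj -> /psi_inj ->].
pose phi (a : D + D) : Z := match a with inl u => sval u | inr u => sval (g u) end.
have phi_inj : injective phi.
  move=> [u|u] [v|v] /=.
  - by move=> /valD_inj ->.
  - by move=> e; case: (svalP (g v)); rewrite -e; exact: svalP.
  - by move=> e; case: (svalP (g u)); rewrite e; exact: svalP.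
  - move=> e; congr inr; apply: g_inj; move: e.
    by case: (g u) (g v) => [x nx] [y ny] /= e; apply: eq_exist.
(* [F] agrees with [fD] on the first copy, so the new graph extends [G]; the three other squares go
   into the second copy, told apart by the tags [t 0], [t 1], [t 2]. *)
pose F (p : (D + D) * (D + D)) : D + D := match p with
  | (inl u, inl v) => inl (fD (u, v))
  | (inl u, inr v) => inr (fD (t 0, fD (u, v)))
  | (inr u, inl v) => inr (fD (t 1, fD (u, v)))
  | (inr u, inr v) => inr (fD (t 2, fD (u, v))) end.
have F_inj : injective F.
  have ff m n p q : fD (t m, fD p) = fD (t n, fD q) -> m = n /\ p = q.
    by move=> /fD_inj[/i_inj -> /fD_inj ->].
  by move=> [[a|a] [b|b]] [[a'|a'] [b'|b']] //= [] => [/fD_inj[-> ->]|||||||||] //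
    /ff[] // _ [-> ->].
pose B : set (Z * Z * Z) := [set p | exists a b, p = (phi a, phi b, phi (F (a, b)))].
have domB a : dom B (phi a) by exists (phi (F (a, a))), a, a.
have /maxG sBG : G `<=` B.
  move=> [[x y] z] Gz; have [dx dy dz] := Gdom _ _ _ Gz.
  exists (inl (exist _ x dx)), (inl (exist _ y dy)) => /=; congr (_, _).
  by have [+ _] := Gfun _ _ Gz (fDG (exist _ x dx, exist _ y dy)) => /(_ erefl).
have : dom G (sval (g (t 0))).
  have [z Bz] := domB (inr (t 0)); exists z; apply: sBG => //.
  split.
  - move=> _ _ [a [b ->]] [a' [b' ->]]; split.
      by move=> [/phi_inj -> /phi_inj ->].
    by move=> /phi_inj/F_inj[-> ->].
  - by move=> _ _ _ [a [b [-> -> ->]]].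
  - by move=> x y [_ [a [_ [-> _ _]]]] [_ [b [_ [-> _ _]]]]; exists (phi (F (a, b))), a, b.
by move/(svalP (g (t 0))).
Qed.
End Square.

Lemma card_le_total (T U : Type) (A : set T) (B : set U) : A #<= B \/ B #<= A.
Proof.
have lift (V W : Type) (C : set V) (D : set W) (f : C -> D) : injective f -> C #<= D.
  by move=> f_inj; apply/card_leP/injfunPex; exists f => // x y _ _ /f_inj.
by case: (inj_total A B) => -[f /lift]; [left|right].
Qed.

Lemma card_le_setT (T : Type) (A : set T) : A #<= [set: A].
Proof. by have := card_setT A; rewrite card_eq_le => /andP[]. Qed.

Lemma card_ge_setT (T : Type) (A : set T) : [set: A] #<= A.
Proof. by have := card_setT A; rewrite card_eq_le => /andP[]. Qed.

Lemma inj_card_leT (T U : Type) (f : T -> U) : injective f -> [set: T] #<= [set: U].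
Proof.
move=> f_inj; apply/card_leP/injfunPex.
exists (fun x => exist _ (f (sval x)) (mem_set (I : [set: U] (f (sval x))))) => //.
by move=> [x ?] [y ?] _ _ [] /f_inj e; apply: val_inj.
Qed.

Section Infinite.
Variables (Z : Type) (i : nat -> Z).
Hypothesis i_inj : injective i.

(** The elements are folded with the pairing of [Z]. The length is recorded as well, because the
    folded code alone does not tell where the sequence ends. *)
Lemma seq_inj : exists f : seq Z -> Z, injective f.
Proof.
have [p p_inj] := square_inj i_inj.
pose fix e (s : seq Z) : Z := if s is x :: s' then p (x, e s') else i 0.
exists (fun s => p (i (size s), e s)) => s t /p_inj[/i_inj + +].
elim: s t => [|x s IH] [|y t] //= [st] /p_inj[-> est].
by rewrite (IH t).
Qed.

Lemma bigcup_card_le (T J : Type) (D : set J) (F : J -> set T) :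
  D #<= [set: Z] -> (forall j, D j -> F j #<= [set: Z]) ->
  \bigcup_(j in D) F j #<= [set: Z].
Proof.
move=> /(card_le_injP _ (i 0))[d d_inj] HF.
have [p p_inj] := square_inj i_inj.
have /choice[f f_inj] (j : J) : exists f : T -> Z,
    D j -> forall x y, F j x -> F j y -> f x = f y -> x = y.
  case: (pselect (D j)) => [Dj|?]; last by exists (fun=> i 0).
  by have /(card_le_injP _ (i 0))[f f_inj] := HF j Dj; exists f.
have /choice[c cD] (x : T) : exists c : option J,
    if c is Some j then D j /\ F j x else ~ (\bigcup_(j in D) F j) x.
  case: (pselect ((\bigcup_(j in D) F j) x)) => [[j Dj Fj]|?]; last by exists None.
  by exists (Some j).
apply/(card_le_injP _ (i 0)).
exists (fun x => if c x is Some j then p (d j, f j x) else i 0) => x y Ux Uy.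
case: (c x) (c y) (cD x) (cD y) => [j|] [k|]//= [Dj Fj] [Dk Fk] /p_inj[/(d_inj _ _ Dj Dk) jk].
by move: Fk; rewrite -jk => Fk; apply: f_inj.
Qed.

Lemma setU_card_le (T : Type) (A B : set T) :
  A #<= [set: Z] -> B #<= [set: Z] -> A `|` B #<= [set: Z].
Proof.
move=> HA HB; rewrite -bigcup2E; apply: bigcup_card_le.
  exact: card_le_trans (subset_card_le (@subsetT _ _)) (inj_card_leT i_inj).
by case=> [|[|n]] _ //=; exact: card_ge0.
Qed.

Lemma image_card_leT (T U : Type) (A : set T) (f : T -> U) :
  A #<= [set: Z] -> f @` A #<= [set: Z].
Proof. exact/card_le_trans/card_image_le. Qed.

Lemma sigT_card_le (S : Type) (X : S -> Type) :
  [set: S] #<= [set: Z] -> (forall s, [set: X s] #<= [set: Z]) ->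
  [set: {s & X s}] #<= [set: Z].
Proof.
move=> HS HX.
apply: (@card_le_trans _ _ _ (\bigcup_(s in [set: S]) (existT X s @` setT))).
  by apply: subset_card_le => -[s x] _; exists s => //; exists x.
by apply: bigcup_card_le => // s _; apply: image_card_leT.
Qed.

End Infinite.

(** By proof irrelevance a transport along a proof of [s = s] is the identity, whatever the type of
    sorts. *)
Lemma existT_inj (S : Type) (X : S -> Type) s (x y : X s) :
  existT X s x = existT X s y -> x = y.
Proof.
move=> e.
have tr (p q : {s & X s}) (e' : p = q) :
    eq_rect _ X (projT2 p) _ (f_equal (@projT1 _ _) e') = projT2 q by case: _ / e'.
by have := tr _ _ e; move: (f_equal _ e) => /= e'; rewrite (Prop_irrelevance e' erefl).
Qed.

Lemma tuple_card_le (Z : Type) (i : nat -> Z) (S : Type) (X : S -> Type) (n : nat)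
    (d : 'I_n -> S) (D : set {s & X s}) :
  injective i -> D #<= [set: Z] ->
  [set a : forall j, X (d j) | forall j, D (existT X (d j) (a j))] #<= [set: Z].
Proof.
move=> i_inj /(card_le_injP _ (i 0))[g g_inj].
have [e e_inj] := seq_inj i_inj.
apply/(card_le_injP _ (i 0)).
exists (fun a => e [seq g (existT X (d j) (a j)) | j <- enum 'I_n]) => a b Da Db.
move=> /e_inj/eq_in_map ab; apply: functional_extensionality_dep => j.
by apply: existT_inj; apply: g_inj; [exact: Da|exact: Db|apply: ab; rewrite mem_enum].
Qed.

Section Small.
Variables (K : Type) (smallN : small K [set: nat]).

Lemma small_card_le (T U : Type) (A : set T) (B : set U) :
  A #<= B -> small K B -> small K A.
Proof.
move=> AB [BK nKB]; split; first exact: card_le_trans AB BK.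
by move=> KA; apply: nKB; exact: card_le_trans KA AB.
Qed.

Lemma small_sub (T : Type) (A B : set T) : A `<=` B -> small K B -> small K A.
Proof. by move=> /subset_card_le; exact: small_card_le. Qed.

Lemma small_image (T U : Type) (f : T -> U) (A : set T) : small K A -> small K (f @` A).
Proof. exact/small_card_le/card_image_le. Qed.

(** By comparability [Z] can be the largest of [A], [B] and [nat]; it is still small, and infinite
    cardinal arithmetic applies in it. *)
Lemma small_bound (T U : Type) (A : set T) (B : set U) :
  small K A -> small K B ->
  exists (Z : Type) (i : nat -> Z),
    [/\ injective i, small K [set: Z], A #<= [set: Z] & B #<= [set: Z]].
Proof.
have bound2 (V W : Type) (C : set V) (D : set W) : small K C -> small K D ->
    exists Z : Type, [/\ small K [set: Z], C #<= [set: Z] & D #<= [set: Z]].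
  move=> sC sD; case: (card_le_total C D) => CD.
    exists D; split; [exact: small_card_le (card_ge_setT D) sD| |exact: card_le_setT].
    exact: card_le_trans CD (card_le_setT D).
  exists C; split; [exact: small_card_le (card_ge_setT C) sC|exact: card_le_setT|].
  exact: card_le_trans CD (card_le_setT C).
move=> sA sB; have [V [sV AV BV]] := bound2 _ _ _ _ sA sB.
have [Z [sZ VZ NZ]] := bound2 _ _ _ _ sV smallN.
have [z0] : inhabited Z.
  move: NZ => /card_leP/injfunPex[f _ _].
  by split; exact: (sval (f (exist _ 0 (mem_set I)))).
move: NZ => /(card_le_injP _ z0)[i i_inj].
exists Z, i; split => //; last exact: card_le_trans BV VZ.
- by move=> m n; exact: i_inj.
- exact: card_le_trans AV VZ.
Qed.

Lemma small_setU (T : Type) (A B : set T) : small K A -> small K B -> small K (A `|` B).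
Proof.
move=> sA sB; have [Z [i [i_inj sZ AZ BZ]]] := small_bound sA sB.
exact: small_card_le (setU_card_le i_inj AZ BZ) sZ.
Qed.

End Small.


(** * Finite lists and sorted families *)

Lemma In_cat (T : Type) (x : T) (l m : list T) :
  List.In x (l ++ m) <-> List.In x l \/ List.In x m.
Proof.
elim: l => [|y l IH] /=; first by split=> [|[]]//; right.
by rewrite IH; split=> [[|[]]|[[]|]]; auto.
Qed.

Lemma el_eq (S : Type) (X : S -> Type) (P : forall t, X t -> Prop) t (y : X t) s (x : X s) :
  existT X t y = existT X s x -> P s x -> P t y.
Proof. by move=> e; rewrite -[P t y]/(P (projT1 (existT X t y)) (projT2 (existT X t y))) e. Qed.

Lemma fhom_ext (S : Type) (X Y : S -> Type) (f g : fhom X Y) :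
  (forall s x, f s x = g s x) -> f = g.
Proof.
by move=> fg; apply: functional_extensionality_dep => s; apply: functional_extensionality_dep.
Qed.

Lemma vjoin_comp (S : Type) (X Y U V : S -> Type) (h : fhom U V) (v : fhom X U)
    (w : fhom Y U) : fcomp h (vjoin v w) = vjoin (fcomp h v) (fcomp h w).
Proof. by apply: fhom_ext => s []. Qed.

Lemma vext_comp (S : Type) (X U V : S -> Type) (h : fhom U V) (v : fhom X U) s (a : U s) :
  fcomp h (vext v a) = vext (fcomp h v) (h s a).
Proof. by apply: fhom_ext => t []. Qed.

(** * Renaming of variables *)

Definition extmap (S : Type) (X Y : S -> Type) (f : fhom X Y) s :
    fhom (ext X s) (ext Y s) :=
  fun t z => match z in ext _ _ t return ext Y s t with
             | Old t x => Old s (f t x)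
             | New => New Y s
             end.

Lemma vext_extmap (S : Type) (X Y U : S -> Type) (f : fhom X Y) (v : fhom Y U) s (a : U s) :
  fcomp (vext v a) (extmap f (s:=s)) = vext (fcomp v f) a.
Proof. by apply: fhom_ext => t []. Qed.

Section Formulas.
Variables (S : Type) (L : language S).
Implicit Types (X Y : S -> Type) (M N U : structure L).

Fixpoint trename X Y (f : fhom X Y) s (t : term L X s) : term L Y s :=
  match t in term _ _ s return term L Y s with
  | Var s x => Var L (f s x)
  | App g ts => App (fun i => trename f (ts i))
  end.

Fixpoint rename X Y (f : fhom X Y) (p : formula L X) : formula L Y :=
  match p with
  | Bot => Bot
  | Eql s t u => Eql (trename f t) (trename f u)
  | Rel r ts => Rel (fun i => trename f (ts i))
  | Imp p q => Imp (rename f p) (rename f q)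
  | All s p => All (rename (extmap f (s:=s)) p)
  end.

Lemma tval_rename U X Y (f : fhom X Y) (v : fhom Y U) s (t : term L X s) :
  tval v (trename f t) = tval (fcomp v f) t.
Proof. by elim: t => //= g ts IH; congr fint; apply: functional_extensionality_dep. Qed.

Lemma sat_rename U X (p : formula L X) : forall Y (f : fhom X Y) (v : fhom Y U),
  sat (rename f p) v <-> sat p (fcomp v f).
Proof.
elim: p => {X} [X|X s t u|X r ts|X p IHp q IHq|X s p IHp] Y f v //=.
- by rewrite !tval_rename.
- suff -> : (fun i => tval v (trename f (ts i))) = (fun i => tval (fcomp v f) (ts i)) by [].
  by apply: functional_extensionality_dep => i; exact: tval_rename.
- by rewrite IHp IHq.
- by split=> H a; have := H a; rewrite IHp vext_extmap.
Qed.

Definition And X (p q : formula L X) : formula L X := Not (Imp p (Not q)).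
Definition Ex X s (p : formula L (ext X s)) : formula L X := Not (All (Not p)).

Lemma sat_Not U X (p : formula L X) (v : fhom X U) : sat (Not p) v <-> ~ sat p v.
Proof. by []. Qed.

Lemma sat_And U X (p q : formula L X) (v : fhom X U) :
  sat (And p q) v <-> sat p v /\ sat q v.
Proof.
by split=> /= [H|[pv qv] H]; [split; apply: contrapT => n; apply: H|exact: H].
Qed.

Lemma sat_Ex U X s (p : formula L (ext X s)) (v : fhom X U) :
  sat (Ex p) v <-> exists a, sat p (vext v a).
Proof.
by split=> /= [H|[a pa] //]; [apply: contrapT => n; apply: H => a ?; apply: n; exists a
  |move/(_ a)].
Qed.

Definition Conj X (l : list (formula L X)) : formula L X := foldr (@And X) (Not Bot) l.

Lemma sat_Conj U X (l : list (formula L X)) (v : fhom X U) :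
  sat (Conj l) v <-> forall p, List.In p l -> sat p v.
Proof.
elim: l => [|p l IH]; first by split=> // _ [].
rewrite [Conj _]/(And p (Conj l)) sat_And IH; split=> [[pv lv] q [<-|/lv]|H] //.
by split=> [|q ql]; apply: H; [left|right].
Qed.

(** * Equivalence of tuples and elementary maps *)

Definition eqv X M N (a : fhom X M) (b : fhom X N) : Prop :=
  forall p : formula L X, sat p a <-> sat p b.

Lemma eqv_sym X M N (a : fhom X M) (b : fhom X N) : eqv a b -> eqv b a.
Proof. by move=> ab p; rewrite ab. Qed.

Lemma eqv_trans X M N U (a : fhom X M) (b : fhom X N) (c : fhom X U) :
  eqv a b -> eqv b c -> eqv a c.
Proof. by move=> ab bc p; rewrite ab. Qed.

Lemma eqv_rename X Y M N (f : fhom X Y) (a : fhom Y M) (b : fhom Y N) :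
  eqv a b -> eqv (fcomp a f) (fcomp b f).
Proof. by move=> ab p; rewrite -(sat_rename p f a) -(sat_rename p f b). Qed.

Lemma sub_eqv X M N (a : fhom X M) (b : fhom X N) :
  (forall p : formula L X, sat p a -> sat p b) -> eqv a b.
Proof.
move=> H p; split; first exact: H.
by move=> pb; apply: contrapT => na; exact: (H (Not p) na pb).
Qed.

Lemma elementary_eqv X M N (h : fhom M N) (a : fhom X M) : elementary h -> eqv a (fcomp h a).
Proof. by move=> hE p; exact: hE. Qed.

Lemma elementary_comp M N U (g : fhom N U) (h : fhom M N) :
  elementary g -> elementary h -> elementary (fcomp g h).
Proof. by move=> gE hE X p v; rewrite hE gE. Qed.

Lemma elementary_models M N (h : fhom M N) (T : theory L) :
  elementary h -> models M T <-> models N T.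
Proof.
move=> hE; have e : fcomp h (@novar S M) = @novar S N by apply: fhom_ext => s [].
by split=> H p /H; rewrite /holds hE e.
Qed.

Lemma embedding_comp M N U (g : fhom N U) (h : fhom M N) :
  embedding g -> embedding h -> embedding (fcomp g h).
Proof.
move=> [g1 g2 g3] [h1 h2 h3]; split=> [s x y /g1/h1//|f a|r a].
  by rewrite /fcomp h2 g2.
by rewrite h3 g3.
Qed.

Lemma tval_embedding M N (h : fhom M N) X (v : fhom X M) s (t : term L X s) :
  embedding h -> tval (fcomp h v) t = h s (tval v t).
Proof.
move=> [_ hf _]; elim: t => //= f ts IH; rewrite hf; congr fint.
exact: functional_extensionality_dep.
Qed.

Lemma surjective_elementary M N (h : fhom M N) :
  embedding h -> (forall s (y : N s), exists x, h s x = y) -> elementary h.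
Proof.
move=> hE hs X p v; have [h1 h2 h3] := hE.
elim: p v => {X} [X|X s t u|X r ts|X p IHp q IHq|X s p IHp] v //=.
- by rewrite !tval_embedding//; split=> [->|/h1].
- rewrite h3; suff -> : (fun i => h _ (tval v (ts i))) = (fun i => tval (fcomp h v) (ts i)) by [].
  by apply: functional_extensionality_dep => i; rewrite tval_embedding.
- by rewrite IHp IHq.
- split=> H a; last by rewrite IHp vext_comp.
  by have [x <-] := hs s a; rewrite -vext_comp -IHp.
Qed.

Lemma sat_qf M N (h : fhom M N) X (p : formula L X) (v : fhom X M) :
  embedding h -> qf p -> sat p v <-> sat p (fcomp h v).
Proof.
move=> hE; have [h1 h2 h3] := hE.
elim: p v => {X} [X|X s t u|X r ts|X p IHp q IHq|X s p IHp] v //=.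
- by rewrite !tval_embedding//; split=> [->|/h1].
- rewrite h3; suff -> : (fun i => h _ (tval v (ts i))) = (fun i => tval (fcomp h v) (ts i)) by [].
  by apply: functional_extensionality_dep => i; rewrite tval_embedding.
- by move=> [qp qq]; rewrite IHp// IHq.
Qed.

Lemma sat_universal M N (h : fhom M N) X (p : formula L X) (v : fhom X M) :
  embedding h -> universal p -> sat p (fcomp h v) -> sat p v.
Proof.
move=> hE; elim: p v => {X} [X|X s t u|X r ts|X p _ q _|X s p IHp] v up.
- by rewrite (sat_qf _ hE).
- by rewrite (sat_qf _ hE).
- by rewrite (sat_qf _ hE).
- by rewrite (sat_qf _ hE).
- by move=> /= H a; apply: IHp => //; rewrite vext_comp; exact: H.
Qed.

Lemma embedding_universal_part M N (h : fhom M N) (T : theory L) :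
  embedding h -> models N (universal_part T) -> models M (universal_part T).
Proof.
move=> hE HN p [Tp up]; apply: (sat_universal hE) => //.
have -> : fcomp h (@novar S M) = @novar S N by apply: fhom_ext => s [].
exact: HN.
Qed.

Lemma models_universal_part M (T : theory L) : models M T -> models M (universal_part T).
Proof. by move=> HM p [/HM]. Qed.

(** * Finite support *)

Lemma finite_union_lists (T : Type) (n : nat) (l : 'I_n -> list T) :
  exists m : list T, forall i x, List.In x (l i) -> List.In x m.
Proof.
exists (flatten [seq l i | i <- enum 'I_n]) => i x.
have := mem_enum 'I_n i; elim: (enum 'I_n) => //= j e IH.
rewrite inE In_cat => /orP[/eqP <-|/IH H]; first by left.
by move=> /H; right.
Qed.

Definition agree X U (l : list (el X)) (v w : fhom X U) : Prop :=
  forall s x, List.In (existT X s x) l -> v s x = w s x.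

Lemma term_support X s (t : term L X s) : exists l, forall U (v w : fhom X U),
  agree l v w -> tval v t = tval w t.
Proof.
elim: t => [s0 x|f ts /choice[l lP]].
  by exists [:: existT X s0 x] => U v w; apply; left.
have [m mP] := finite_union_lists l.
exists m => U v w vw /=; congr fint; apply: functional_extensionality_dep => i.
by apply: lP => s0 x /mP; exact: vw.
Qed.

Lemma support X (p : formula L X) : exists l, forall U (v w : fhom X U),
  agree l v w -> sat p v <-> sat p w.
Proof.
elim: p => {X} [X|X s t u|X r ts|X p [l lP] q [m mP]|X s p [l lP]].
- by exists [::].
- have [[l lP] [m mP]] := (term_support t, term_support u).
  exists (l ++ m) => U v w vw /=.
  by rewrite (lP _ v w) ?(mP _ v w)// => s0 x ?; apply: vw; rewrite In_cat; [right|left].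
- have /choice[l lP] i := term_support (ts i).
  have [m mP] := finite_union_lists l.
  exists m => U v w vw /=.
  suff -> : (fun i => tval v (ts i)) = (fun i => tval w (ts i)) by [].
  apply: functional_extensionality_dep => i; apply: lP => s0 x /mP; exact: vw.
- exists (l ++ m) => U v w vw /=.
  by rewrite (lP _ v w) ?(mP _ v w)// => s0 x ?; apply: vw; rewrite In_cat; [right|left].
- pose old (e : el (ext X s)) : list (el X) :=
    match projT2 e in ext _ _ t return list (el X) with
    | Old t x => [:: existT X t x] | New => [::] end.
  exists (flatten (map old l)) => U v w vw /=.
  have H a : sat p (vext v a) <-> sat p (vext w a).
    apply: lP => t z; case: z => {t} [t x|] //= xl; apply: vw.
    elim: l xl => //= e l IH [->|/IH H]; first by left.
    by rewrite In_cat; right.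
  by split=> h a; apply/H.
Qed.

(** * Existential quantification over finitely many variables *)

(** For quantifying a single variable [x] of an arbitrary family: renaming by [f] turns it into the
    bound variable. Equality with [x] is decided classically. *)
Lemma to_ext X s (x : X s) : exists f : fhom X (ext X s),
  f s x = New X s /\
  forall t y, existT X t y <> existT X s x -> f t y = Old s y.
Proof.
have ex t (y : X t) : exists z : ext X s t,
    (existT X t y = existT X s x -> existT (ext X s) t z = existT _ s (New X s)) /\
    (existT X t y <> existT X s x -> z = Old s y).
  case: (pselect (existT X t y = existT X s x)) => [e|ne]; last by exists (Old s y).
  by have ts := existT_inj1 e; case: _ / (esym ts) y e => y e; exists (New X s).
exists (fun t y => projT1 (cid (ex t y))); split=> [|t y]; case: (cid _) => z /= [e ne] //.
by apply: existT_inj; exact: e.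
Qed.

(** Formulas bind one variable at a time, so the block is peeled off along [l]. Solutions are whole
    assignments [w], which avoids tuples indexed by [l]. *)
Lemma exblock X (l : list (el X)) (p : formula L X) : exists q : formula L X,
  forall U (v : fhom X U), sat q v <-> exists2 w : fhom X U,
    forall s x, ~ List.In (existT X s x) l -> w s x = v s x & sat p w.
Proof.
elim: l => [|[s x] l [q qP]].
  exists p => U v; split=> [pv|[w wv pw]]; first by exists v.
  by have <- : w = v by apply: fhom_ext => s x; exact: wv.
have [f [fx fy]] := to_ext x; exists (Ex (rename f q)) => U v; rewrite sat_Ex.
have upd (a : U s) : (fcomp (vext v a) f) s x = a by rewrite /fcomp fx.
have old (a : U s) t y : existT X t y <> existT X s x -> (fcomp (vext v a) f) t y = v t y.
  by move=> /fy; rewrite /fcomp => ->.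
split=> [[a]|[w wv pw]].
  rewrite sat_rename qP => -[w wv pw]; exists w => // t y nl.
  rewrite wv; last by move=> ?; apply: nl; right.
  by apply: old => e; apply: nl; left.
exists (w s x); rewrite sat_rename qP; exists w => // t y nl.
case: (pselect (existT X t y = existT X s x)) => [e|ne]; last first.
  by rewrite old// wv// => -[/esym/ne|/nl].
by apply: (el_eq (P := fun t y => w t y = fcomp (vext v (w s x)) f y) e); rewrite upd.
Qed.

Lemma elementary_inhabited M N (h : fhom M N) s (y : N s) :
  elementary h -> exists x : M s, True.
Proof.
move=> /(_ _ (Ex (Not (@Bot S L (ext (@nofam S) s)))) (@novar S M))[_].
by rewrite !sat_Ex => -[|x _]; [exists y|exists x].
Qed.

(** The family [X] may be infinite, but [p] mentions finitely many of its variables; these are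
    quantified by [exblock] and the existential formula is pulled back along [h]. *)
Lemma elementary_exists M N (h : fhom M N) X Y (m : fhom Y M) (c : fhom X N)
    (p : formula L (join X Y)) :
  elementary h -> sat p (vjoin c (fcomp h m)) -> exists c' : fhom X M, sat p (vjoin c' m).
Proof.
move=> hE pc.
(* Arbitrary starting values in [M]. Sorts may be empty, but the sort of [c s x] is inhabited in
   [N], hence in [M]. *)
pose c0 s (x : X s) : M s := projT1 (cid (elementary_inhabited (c s x) hE)).
have [l lP] := support p.
pose J := join X Y.
have [k kP] : exists k : list (el X), forall s x,
    List.In (existT J s (inl x)) l -> List.In (existT X s x) k.
  exists (flatten (map (fun e : el J => match projT2 e with
     | inl x => [:: existT X (projT1 e) x] | inr _ => [::] end) l)) => s x.
  elim: l {lP} => //= e l IH [->|/IH H]; first by left.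
  by rewrite In_cat; right.
pose inlm : fhom X J := fun s x => inl x.
have [q qP] := exblock (map (elmap inlm) k) p.
pose w : fhom J N := vjoin (fun s x =>
  if pselect (List.In (existT X s x) k) then c s x else h s (c0 s x)) (fcomp h m).
have : sat q (fcomp h (vjoin (c0 : fhom X M) m)).
  rewrite qP; exists w.
    move=> s [x|y] //= nk; case: pselect => // xk; exfalso; apply: nk.
    by apply/List.in_map_iff; exists (existT X s x).
  apply/(lP _ w (vjoin c (fcomp h m))) => // s [x|y] //= xl.
  by case: pselect => // -[]; exact: kP.
rewrite -hE qP => -[w' w'v pw']; exists (fcomp w' inlm).
rewrite (_ : vjoin _ _ = w')//; apply: fhom_ext => s [x|y] //=.
rewrite w'v// => /List.in_map_iff[e [+ _]].
by move/(f_equal (fun z : el J => if projT2 z is inl _ then True else False)) => /= <-.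
Qed.
End Formulas.

(** * Elementary substructures *)

Lemma finite_list (T : Type) (A : set T) :
  finite_set A -> exists l : list T, forall x, A x <-> List.In x l.
Proof.
move=> /(@finite_seqP {classic T})[l ->]; exists l => x /=.
elim: l => //= y l IH; rewrite inE; split=> [/orP[/eqP ->|/IH]|[->|/IH ->]].
- by left.
- by right.
- by rewrite eqxx.
- by rewrite orbT.
Qed.

Lemma list_finite (T : Type) (l : list T) : finite_set [set x | List.In x l].
Proof.
elim: l => [|y l IH]; first by apply: (sub_finite_set _ (@finite_set0 T)).
have : finite_set ([set y] `|` [set x | List.In x l]) by rewrite finite_setU; split.
by apply: sub_finite_set => x /= [<-|]; [left|right].
Qed.

Definition subfam_sub (S : Type) (X : S -> Type) (A B : set (el X)) (AB : A `<=` B) :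
    fhom (subfam A) (subfam B) :=
  fun s x => exist _ (sval x) (AB _ (svalP x)).

Section Substructures.
Variables (S : Type) (L : language S).
Implicit Types (X Y : S -> Type) (M N U : structure L).

Definition substr U (P : set (el U)) (cP : closed_subset P) : structure L :=
  @Structure S L (subfam P)
    (fun f a => exist _ (fint (fun i => sval (a i))) (cP f _ (fun i => svalP (a i))))
    (fun r a => rint (fun i => sval (a i))).

Definition substr_inc U (P : set (el U)) (cP : closed_subset P) : fhom (substr cP) U :=
  @subfam_inc S U P.
Arguments substr_inc {U P} cP s _.

Lemma substr_embedding U (P : set (el U)) (cP : closed_subset P) :
  embedding (substr_inc cP).
Proof. by split=> // s [x px] [y py] /= xy; exact: eq_exist. Qed.

Definition esub U (P : set (el U)) : Prop :=
  exists cP : closed_subset P, elementary (substr_inc cP).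

Lemma esub_TV U (P : set (el U)) :
  (forall s (p : formula L (ext (subfam P) s)),
    (exists y, sat p (vext (@subfam_inc S U P) y)) ->
    exists y : subfam P s, sat p (vext (@subfam_inc S U P) (sval y))) -> esub P.
Proof.
move=> TV.
have cP : closed_subset P.
  move=> f a Pa.
  (* Closure under function symbols comes from the Tarski-Vaught test itself, for the formula
     [f(a) = y]. *)
  have [|y e] := TV _ (Eql (App (fun i => Var L (Old _ (exist _ (a i) (Pa i)))))
    (Var L (New (subfam P) (fcod f)))).
    by exists (fint a).
  by have -> : fint a = sval y := e; exact: (proj2_sig y).
exists cP; have [inj _ _] := substr_embedding cP => X p.
elim: p => {X} [X|X s t u|X r ts|X p IHp q IHq|X s p IHp] v //=.
- by rewrite !(tval_embedding _ _ (substr_embedding cP)); split=> [->|/inj].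
- suff -> : (fun i => tval (fcomp (substr_inc cP) v) (ts i)) =
    (fun i => sval (tval v (ts i))) by [].
  by apply: functional_extensionality_dep => i; rewrite (tval_embedding _ _ (substr_embedding cP)).
- by rewrite IHp IHq.
- split=> H a; last by rewrite IHp vext_comp.
  apply: contrapT => na; have [|y] := TV _ (Not (rename (extmap v (s:=s)) p)).
    by exists a; rewrite sat_Not sat_rename vext_extmap.
  rewrite sat_Not sat_rename vext_extmap; apply.
  by have := H y; rewrite IHp vext_comp.
Qed.

Lemma trange_comp X (U V : S -> Type) (h : fhom U V) (a : fhom X U) :
  trange (fcomp h a) = elmap h @` trange a.
Proof. by rewrite /trange image_comp. Qed.

Lemma trange_inc X (P : set (el X)) : trange (@subfam_inc S X P) = P.
Proof.
apply/seteqP; split=> [_ [[s [x px]] _ <-]|[s x] px]//.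
by exists (existT _ s (exist _ x px)).
Qed.

Lemma trangeP X (U : S -> Type) (a : fhom X U) s (y : U s) :
  trange a (existT U s y) <-> exists x, a s x = y.
Proof.
split=> [[[t x] _ e]|[x <-]]; last by exists (existT X s x).
by apply: (el_eq (P := fun s y => exists x, a s x = y) (esym e)); exists x.
Qed.

Lemma imageP_el (U V : S -> Type) (h : fhom U V) (P : set (el U)) s (y : V s) :
  (elmap h @` P) (existT V s y) <-> exists x, P (existT U s x) /\ h s x = y.
Proof.
split=> [[[t x] Px e]|[x [Px <-]]]; last by exists (existT U s x).
by apply: (el_eq (P := fun s y => exists x, P (existT U s x) /\ h s x = y) (esym e)); exists x.
Qed.

Lemma esub_trange M U (g : fhom M U) : elementary g -> esub (trange g).
Proof.
move=> gE; apply: esub_TV => s p.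
have ex t (x : subfam (trange g) t) : exists z : M t, g t z = sval x.
  by apply/trangeP; exact: (proj2_sig x).
pose c t (x : subfam (trange g) t) : M t := projT1 (cid (ex t x)).
have gc : fcomp g c = @subfam_inc S U (trange g).
  by apply: fhom_ext => t x; exact: (projT2 (cid (ex t x))).
move=> /sat_Ex; rewrite -gc -(gE _ (Ex p)) => /sat_Ex[y py].
have gy : trange g (existT U s (g s y)) by apply/trangeP; exists y.
by exists (exist _ (g s y) gy); move: py; rewrite gE vext_comp gc.
Qed.

Lemma eqv_tp X M (B : set (el M)) (a b : fhom X M) :
  tp (L:=L) B a = tp B b <->
  eqv (L:=L) (vjoin a (@subfam_inc S M B)) (vjoin b (@subfam_inc S M B)).
Proof.
split=> [e p|e]; last by apply/seteqP; split=> p /e.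
by have := f_equal (fun T => T p) e; rewrite /tp /= => ->.
Qed.

Lemma realises_eqv X M (B : set (el M)) (a b : fhom X M) :
  realises (L:=L) (tp B a) b ->
  eqv (L:=L) (vjoin a (@subfam_inc S M B)) (vjoin b (@subfam_inc S M B)).
Proof. by move=> ab; apply: sub_eqv => p /ab. Qed.
End Substructures.
Arguments substr_inc {S L U P} cP s _.


(** * Algebraic closure and automorphisms *)

Section Elementary.
Variables (S : Type) (L : language S).
Implicit Types (X Y : S -> Type) (M N U : structure L).

Lemma esub_image M N (h : fhom M N) (P : set (el M)) :
  elementary h -> esub P -> esub (elmap h @` P).
Proof.
move=> hE [cP PE]; have := esub_trange (elementary_comp hE PE).
by rewrite trange_comp trange_inc.
Qed.

Lemma esub_witness U (P : set (el U)) s (p : formula L (ext (subfam P) s)) :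
  esub P -> (exists y, sat p (vext (@subfam_inc S U P) y)) ->
  exists y : subfam P s, sat p (vext (@subfam_inc S U P) (sval y)).
Proof.
move=> [cP PE] /sat_Ex; rewrite -[@subfam_inc S U P]/(fcomp (substr_inc cP) (fun t x => x)).
rewrite -(PE _ (Ex p)) => /sat_Ex[y py]; exists y.
by move: py; rewrite PE vext_comp.
Qed.

Lemma sub_acl U (A : set (el U)) : A `<=` acl A.
Proof.
move=> [s x] Ax; exists (Eql (Var L (New (subfam A) s)) (Var L (Old s (exist _ x Ax)))) => /=.
by split=> //; exact: finite_set1.
Qed.

(** The solutions of [p] in [P] form a finite list [l]. If [x] lay outside [P], it would satisfy [p]
    and differ from all of [l]; by elementarity [P] would contain such a point too. *)
Lemma acl_esub U (A P : set (el U)) : esub P -> A `<=` P -> acl A `<=` P.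
Proof.
move=> PE AP [s x] [p []] /=; set phi := [set y | _] => phix fin_phi.
have /finite_list[l lP] : finite_set [set y : subfam P s | phi (sval y)].
  apply: (finite_preimage _ fin_phi).
  by move=> [y py] [z pz] _ _ /= yz; exact: eq_exist.
pose q := And (rename (extmap (subfam_sub AP) (s:=s)) p)
  (Conj (map (fun y => Not (Eql (Var L (New (subfam P) s)) (Var L (Old s y)))) l)).
apply: contrapT => nPx; have [|y] := esub_witness (p:=q) PE.
  exists x; rewrite sat_And sat_rename vext_extmap sat_Conj; split=> // r.
  by move=> /List.in_map_iff[[y Py] [<- _]] /= e; apply: nPx; rewrite e.
rewrite sat_And sat_rename vext_extmap sat_Conj => -[/lP yl H].
by apply: (H (Not (Eql (Var L (New (subfam P) s)) (Var L (Old s y))))) => //;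
  apply/List.in_map_iff; exists y.
Qed.

Definition fid X : fhom X X := fun s x => x.

Lemma automorphism_elementary U (h : fhom U U) : automorphism h -> elementary h.
Proof. by move=> [hE hs]; exact: surjective_elementary. Qed.

Lemma automorphism_comp U (g h : fhom U U) :
  automorphism g -> automorphism h -> automorphism (fcomp g h).
Proof.
move=> [gE gs] [hE hs]; split; first exact: embedding_comp.
by move=> s y; have [z <-] := gs s y; have [x <-] := hs s z; exists x.
Qed.

Lemma automorphism_inv U (h : fhom U U) : automorphism h ->
  exists g : fhom U U, [/\ automorphism g, forall s x, g s (h s x) = x
    & forall s x, h s (g s x) = x].
Proof.
move=> [[h1 h2 h3] hs]; pose g : fhom U U := fun s y => projT1 (cid (hs s y)).
have hg s x : h s (g s x) = x by exact: (projT2 (cid (hs s x))).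
have gh s x : g s (h s x) = x by apply: h1; rewrite hg.
exists g; split=> //; split; last by move=> s y; exists (h s y).
split=> [s x y e|f a|r a].
- by rewrite -(hg s x) e hg.
- apply: h1; rewrite hg h2; congr fint.
  by apply: functional_extensionality_dep => i; rewrite hg.
- rewrite (h3 r (fun i => g _ (a i))); suff -> : (fun i => h _ (g _ (a i))) = a by [].
  by apply: functional_extensionality_dep => i; rewrite hg.
Qed.

Definition fixes U (h : fhom U U) (B : set (el U)) : Prop :=
  forall s x, B (existT U s x) -> h s x = x.

Lemma fixes_image U (h : fhom U U) (B : set (el U)) : fixes h B -> elmap h @` B = B.
Proof.
move=> hB; apply/seteqP; split=> [_ [[s x] Bx <-]|[s x] Bx].
  by rewrite /elmap /= hB.
by exists (existT _ s x) => //; rewrite /elmap /= hB.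
Qed.

Lemma fixes_comp U (g h : fhom U U) (B : set (el U)) :
  fixes g B -> fixes h B -> fixes (fcomp g h) B.
Proof. by move=> gB hB s x Bx; rewrite /fcomp hB// gB. Qed.

Lemma fixes_sub U (h : fhom U U) (A B : set (el U)) : A `<=` B -> fixes h B -> fixes h A.
Proof. by move=> AB hB s x /AB/hB. Qed.

End Elementary.

(** * Counting formulas, and the downward Loewenheim-Skolem theorem *)

Lemma elmap_inj (S : Type) (X Y : S -> Type) (h : fhom X Y) :
  (forall s x y, h s x = h s y -> x = y) -> injective (elmap h).
Proof.
move=> h_inj [s x] [t y] e.
have ts : t = s := esym (existT_inj1 e).
move: y e; rewrite ts => y e; congr existT; apply: h_inj; exact: existT_inj e.
Qed.

Lemma elmap_inc_inj (S : Type) (X : S -> Type) (B : set (el X)) :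
  injective (elmap (@subfam_inc S X B)).
Proof. by apply: elmap_inj => s [u pu] [v pv] /= uv; exact: eq_exist. Qed.

Section SmallFamilies.
Variables (K S : Type) (smallN : small K [set: nat]).

Lemma small_subfam (X : S -> Type) (B : set (el X)) :
  small K B -> small K [set: el (subfam B)].
Proof.
apply: small_card_le; apply: (@card_le_trans _ _ _ (trange (@subfam_inc S X B))).
  have := @inj_card_eq _ _ [set: el (subfam B)] (elmap (@subfam_inc S X B)).
  rewrite card_eq_le => /(_ _)/andP[] // x y _ _; exact: elmap_inc_inj.
by rewrite trange_inc; exact: card_lexx.
Qed.

Lemma small_trange (X U : S -> Type) (a : fhom X U) :
  small K [set: el X] -> small K (trange a).
Proof. exact: small_image. Qed.

Lemma small_join (X Y : S -> Type) :
  small K [set: el X] -> small K [set: el Y] -> small K [set: el (join X Y)].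
Proof.
move=> sX sY; pose il : fhom X (join X Y) := fun s x => inl x.
pose ir : fhom Y (join X Y) := fun s x => inr x.
apply: (@small_sub _ _ _ (trange il `|` trange ir)).
  by move=> [s [x|y]] _; [left; exists (existT X s x)|right; exists (existT Y s y)].
by apply: small_setU => //; exact: small_trange.
Qed.

End SmallFamilies.

Section Counting.
Variables (Z : Type) (i : nat -> Z) (S : Type) (L : language S).
Hypotheses (i_inj : injective i) (SZ : [set: S] #<= [set: Z])
  (fZ : [set: Defs.fsym L] #<= [set: Z]) (rZ : [set: rsym L] #<= [set: Z]).
Implicit Types (X : S -> Type).

Lemma set1_card_le (T : Type) (x : T) : [set x] #<= [set: Z].
Proof. by apply/(card_le_injP _ (i 0)); exists (fun=> i 0) => ? ? -> ->. Qed.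

Lemma nat_card_le : [set: nat] #<= [set: Z].
Proof. exact: inj_card_leT i_inj. Qed.

Lemma fiber_card_le (X : S -> Type) s : [set: el X] #<= [set: Z] -> [set: X s] #<= [set: Z].
Proof.
apply: card_le_trans; apply: (@inj_card_leT _ _ (existT X s)) => x y; exact: existT_inj.
Qed.

Fixpoint tdepth X s (t : term L X s) : nat :=
  match t with
  | Var _ _ => 0
  | App f ts => (\max_(j < far f) tdepth (ts j)).+1
  end.

Fixpoint fdepth X (p : formula L X) : nat :=
  match p with
  | Bot | Eql _ _ _ | Rel _ _ => 0
  | Imp p q => (maxn (fdepth p) (fdepth q)).+1
  | All _ p => (fdepth p).+1
  end.

(** Terms are stratified by depth: each is a variable or a symbol applied to a tuple of terms of
    smaller depth, and there are countably many layers. *)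
Lemma term_card_le X : [set: el X] #<= [set: Z] -> [set: el (term L X)] #<= [set: Z].
Proof.
move=> XZ; pose D n := [set e : el (term L X) | (tdepth (projT2 e) < n)%N].
apply: (@card_le_trans _ _ _ (\bigcup_(n in setT) D n)).
  by apply: subset_card_le => e _; exists (tdepth (projT2 e)).+1 => //=; exact: ltnSn.
apply: (bigcup_card_le i_inj nat_card_le) => n _; elim: n => [|n IH].
  by have -> : D 0 = set0; [apply/seteqP; split=> e //=|exact: card_ge0].
pose T f := [set a : forall j, term L X (@fdom S L f j) | forall j, D n (existT _ _ (a j))].
apply: (@card_le_trans _ _ _ (elmap (@Var S L X) @` setT `|`
    \bigcup_(f in [set: Defs.fsym L]) (fun a => existT _ (fcod f) (App a)) @` T f)).
  apply: subset_card_le => -[s t]; case: t => {s} [s x|f ts] /= tn.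
    by left; exists (existT X s x).
  right; exists f => //; exists ts => // j; rewrite /D /=.
  exact: leq_ltn_trans (leq_bigmax j) tn.
apply: (setU_card_le i_inj) => //; first exact: image_card_leT.
apply: (bigcup_card_le i_inj fZ) => f _; apply: image_card_leT.
exact: tuple_card_le i_inj IH.
Qed.

Lemma ext_card_le X s : [set: el X] #<= [set: Z] -> [set: el (ext X s)] #<= [set: Z].
Proof.
move=> XZ; apply: (@card_le_trans _ _ _ ([set existT _ s (New X s)] `|`
    elmap (Old s) @` [set: el X])).
  by apply: subset_card_le => -[t z] _; case: z => [{}t x|]; [right; exists (existT X t x)|left].
by apply: (setU_card_le i_inj) => //; [exact: set1_card_le|exact: image_card_leT].
Qed.

Lemma formula_card_le X : [set: el X] #<= [set: Z] -> [set: formula L X] #<= [set: Z].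
Proof.
move=> XZ; pose D X n := [set p : formula L X | (fdepth p < n)%N].
apply: (@card_le_trans _ _ _ (\bigcup_(n in setT) D X n)).
  by apply: subset_card_le => e _; exists (fdepth e).+1 => //=; exact: ltnSn.
(* The induction is over all families [X] at once, since a quantifier adds a variable. *)
apply: (bigcup_card_le i_inj nat_card_le) => n _; elim: n X XZ => [|n IH] X XZ.
  by have -> : D X 0 = set0; [apply/seteqP; split=> e //=|exact: card_ge0].
pose E := \bigcup_(s in [set: S]) \bigcup_(t in [set: term L X s])
  \bigcup_(u in [set: term L X s]) [set Eql t u].
pose R := \bigcup_(r in [set: rsym L]) @Rel S L X r @` setT.
pose I := \bigcup_(p in D X n) \bigcup_(q in D X n) [set Imp p q].
pose A := \bigcup_(s in [set: S]) @All S L X s @` D (ext X s) n.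
apply: (@card_le_trans _ _ _ ([set Bot] `|` E `|` R `|` I `|` A)).
  apply: subset_card_le => -[|s t u|r ts|p q|s p]; rewrite /D /= => pn.
  - by left; left; left; left.
  - by left; left; left; right; exists s => //; exists t => //; exists u.
  - by left; left; right; exists r => //; exists ts.
  - by left; right; move: pn; rewrite ltnS gtn_max => /andP[pn qn]; exists p => //; exists q.
  - by right; exists s => //; exists p.
have TZ := term_card_le XZ.
do 4?[apply: (setU_card_le i_inj) => //].
- exact: set1_card_le.
- apply: (bigcup_card_le i_inj SZ) => s _.
  apply: (bigcup_card_le i_inj (fiber_card_le _ TZ)) => t _.
  apply: (bigcup_card_le i_inj (fiber_card_le _ TZ)) => u _; exact: set1_card_le.
- apply: (bigcup_card_le i_inj rZ) => r _; apply: image_card_leT.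
  apply: card_le_trans (tuple_card_le (@rdom S L r) i_inj TZ).
  exact: subset_card_le.
- apply: (bigcup_card_le i_inj (IH _ XZ)) => p _.
  apply: (bigcup_card_le i_inj (IH _ XZ)) => q _; exact: set1_card_le.
- apply: (bigcup_card_le i_inj SZ) => s _; apply: image_card_leT; apply: IH.
  exact: ext_card_le.
Qed.

Lemma subfam_card_le X (B : set (el X)) :
  B #<= [set: Z] -> [set: el (subfam B)] #<= [set: Z].
Proof.
move=> /(card_le_injP _ (i 0))[f f_inj]; apply/(card_le_injP _ (i 0)).
exists (fun e => f (elmap (@subfam_inc S X B) e)) => -[s [x Bx]] [t [y By]] _ _.
by move=> e; apply: (@elmap_inc_inj S X B); exact: f_inj e.
Qed.

(** [P] is the union of a chain [Q n], where each step adds a witness [W] for every satisfiable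
    formula with parameters in the previous set. The bound by [Z] is kept because there are at most
    [Z] such formulas. *)
Lemma downward_lowenheim_skolem (U : structure L) (A : set (el U)) :
  A #<= [set: Z] -> exists P : set (el U), [/\ esub P, A `<=` P & P #<= [set: Z]].
Proof.
move=> AZ.
pose W (P : set (el U)) (e : {s & formula L (ext (subfam P) s)}) : set (el U) :=
  if pselect (exists y, sat (projT2 e) (vext (@subfam_inc S U P) y)) is left h
  then [set existT U (projT1 e) (projT1 (cid h))] else set0.
have WZ P e : W P e #<= [set: Z].
  by rewrite /W; case: pselect => h; [exact: set1_card_le|exact: card_ge0].
(* One point of each inhabited sort goes into [Q 0], so that every [Q n] has a default value for
   parameters of that sort. *)
pose C s : set (el U) :=
  if pselect (exists y : U s, True) is left h then [set existT U s (projT1 (cid h))] else set0.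
pose next P := P `|` \bigcup_(e in setT) W P e.
pose Q n := iter n next (A `|` \bigcup_(s in setT) C s).
have QZ n : Q n #<= [set: Z].
  elim: n => [|n IH] /=; apply: (setU_card_le i_inj) => //.
    by apply: (bigcup_card_le i_inj SZ) => s _; rewrite /C; case: pselect => h;
      [exact: set1_card_le|exact: card_ge0].
  apply: (bigcup_card_le i_inj) => //; apply: (sigT_card_le i_inj) => // s.
  by apply: formula_card_le; apply: ext_card_le; apply: subfam_card_le.
have Qle m n : (m <= n)%N -> Q m `<=` Q n.
  move=> /subnK <-; elim: (n - m)%N => //= k IH e /IH; by left.
have Q0 n s (y : U s) : exists z : U s, Q n (existT U s z).
  case: (pselect (exists y : U s, True)) => [h|[]]; last by exists y.
  exists (projT1 (cid h)); apply: (Qle 0) => //; right; exists s => //; rewrite /C.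
  by case: pselect => // h'; rewrite (Prop_irrelevance h' h).
pose P := \bigcup_(n in [set: nat]) Q n.
exists P; split; last by apply: (bigcup_card_le i_inj nat_card_le) => n _.
  apply: esub_TV => s p [y py]; have [l lP] := support p.
  (* A formula has finite support, so all parameters that matter lie in a single [Q n]. *)
  have [n nP] : exists n, forall t x, List.In (existT _ t (@Old S (subfam P) s t x)) l ->
      Q n (existT U t (sval x)).
    elim: l {lP} => [|e l [n nP]]; first by exists 0.
    case: (pselect (exists t x, e = existT _ t (@Old S (subfam P) s t x))) => [[t [x ->]]|ne].
      have [m _ mx] := proj2_sig x; exists (maxn m n) => t' x' /= [e'|/nP].
        apply: (Qle m); first exact: leq_maxl.
        pose G (z : el (ext (subfam P) s)) := if projT2 z is Old t x
          then Q m (existT U t (sval x)) else True.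
        by have := f_equal G e'; rewrite /G /= => <-.
      exact/Qle/leq_maxr.
    by exists n => t x /= [e'|/nP//]; case: ne; exists t, x.
  have ex t (x : subfam P t) : exists x' : subfam (Q n) t,
      Q n (existT U t (sval x)) -> sval x' = sval x.
    case: (pselect (Q n (existT U t (sval x)))) => [Qx|nQ].
      by exists (exist (fun y => Q n (existT U t y)) _ Qx).
    by have [z Qz] := Q0 n t (sval x); exists (exist (fun y => Q n (existT U t y)) z Qz).
  (* Parameters outside [Q n] are not in the support of [p] and are sent to default values. *)
  pose c : fhom (subfam P) (subfam (Q n)) := fun t x => projT1 (cid (ex t x)).
  pose p' := rename (extmap c (s:=s)) p.
  have p'p z : sat p' (vext (@subfam_inc S U (Q n)) z) <-> sat p (vext (@subfam_inc S U P) z).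
    rewrite sat_rename vext_extmap; apply: lP => t x; case: x => [{}t x|] //= /nP.
    exact: (projT2 (cid (ex t x))).
  have h : exists z, sat p' (vext (@subfam_inc S U (Q n)) z) by exists y; rewrite p'p.
  have Pz : P (existT U s (projT1 (cid h))).
    exists n.+1 => //=; right; exists (existT _ s p') => //; rewrite /W /=.
    by case: pselect => // h'; rewrite (Prop_irrelevance h' h).
  by exists (exist (fun y => P (existT U s y)) _ Pz); rewrite -p'p; exact: (projT2 (cid h)).
by move=> e Ae; exists 0 => //; left.
Qed.

End Counting.

Lemma small_esub (K S : Type) (L : language S) (U : structure L) (A : set (el U)) :
  large_for K L -> small K A -> exists P : set (el U), [/\ esub P, A `<=` P & small K P].
Proof.
move=> [smallN sS sf sr] sA.
have [Z1 [_ [_ sZ1 AZ1 SZ1]]] := small_bound smallN sA sS.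
have [Z2 [_ [_ sZ2 fZ2 rZ2]]] := small_bound smallN sf sr.
have [Z [i [i_inj sZ Z1Z Z2Z]]] := small_bound smallN sZ1 sZ2.
have [||||P [PE AP PZ]] := @downward_lowenheim_skolem Z i S L i_inj _ _ _ U A.
- exact: card_le_trans SZ1 Z1Z.
- exact: card_le_trans fZ2 Z2Z.
- exact: card_le_trans rZ2 Z2Z.
- exact: card_le_trans AZ1 Z1Z.
by exists P; split => //; exact: small_card_le PZ sZ.
Qed.


(** * Monster models: homogeneity, saturation and algebraic closure *)

Lemma small_ext (K S : Type) (smallN : small K [set: nat]) (X : S -> Type) s :
  small K [set: el X] -> small K [set: el (ext X s)].
Proof.
move=> sX; apply: (@small_sub _ _ _ ([set existT _ s (New X s)] `|`
    elmap (Old s) @` [set: el X])).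
  by move=> [t z] _; case: z => [{}t x|]; [right; exists (existT X t x)|left].
apply: small_setU => //; last exact: small_image.
apply: small_card_le smallN; apply/(card_le_injP _ 0).
by exists (fun=> 0) => ? ? -> ->.
Qed.

Section Monster.
Variables (K S : Type) (L : language S) (T : theory L) (U : structure L).
Hypotheses (hK : large_for K L) (hU : monster K T U).
Implicit Types (X Y : S -> Type) (A B C P : set (el U)) (h : fhom U U).

Let smallN : small K [set: nat].
Proof. by case: hK. Qed.

Lemma homogeneous X (a b : fhom X U) :
  small K [set: el X] -> eqv a b -> exists2 h, automorphism h & fcomp h a = b.
Proof.
move=> sX ab; have [_ _ H] := hU.
have [|h hA hab] := H X a b sX; last by exists h => //; apply: fhom_ext.
apply/eqv_tp.
pose f : fhom (join X (subfam (@set0 (el U)))) X :=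
  fun s z => match z with inl x => x | inr y => match proj2_sig y with end end.
have -> : vjoin a (@subfam_inc S U set0) = fcomp a f by apply: fhom_ext => s [x|[? []]].
have -> : vjoin b (@subfam_inc S U set0) = fcomp b f by apply: fhom_ext => s [x|[? []]].
exact: eqv_rename.
Qed.

Lemma homogeneous_over X (a b : fhom X U) B :
  small K [set: el X] -> small K B ->
  eqv (vjoin a (@subfam_inc S U B)) (vjoin b (@subfam_inc S U B)) ->
  exists h, [/\ automorphism h, fcomp h a = b & fixes h B].
Proof.
move=> sX sB /homogeneous[|h hA e].
  by apply: small_join => //; exact: small_subfam.
have he s z : h s (vjoin a (@subfam_inc S U B) z) = vjoin b (@subfam_inc S U B) z.
  by rewrite -e.
exists h; split=> //; first by apply: fhom_ext => s x; exact: (he s (inl x)).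
by move=> s x Bx; exact: (he s (inr (exist (fun x => B (existT U s x)) x Bx))).
Qed.

Lemma tp_automorphism X (a b : fhom X U) B :
  small K [set: el X] -> small K B -> tp (L:=L) B a = tp B b ->
  exists h, [/\ automorphism h, fcomp h a = b & fixes h B].
Proof. by move=> sX sB /eqv_tp; exact: homogeneous_over. Qed.

(** Brings a tuple of an elementary extension [N] of [B] back into [U]. A finite part of its type
    over [B] is realised in [B], as [k] is elementary, hence in [U]; saturation realises the
    whole. *)
Lemma saturated_realize B (cB : closed_subset B) (N : structure L)
    (k : fhom (substr cB) N) X (c : fhom X N) :
  elementary (substr_inc cB) -> elementary k -> small K [set: el X] -> small K B ->
  exists c' : fhom X U,
    eqv (vjoin c (k : fhom (subfam B) N)) (vjoin c' (@subfam_inc S U B)).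
Proof.
move=> BE kE sX sB; have [_ H _] := hU.
pose p : set (formula L (join X (subfam B))) := [set q | sat q (vjoin c k)].
have [||q qp /finite_list[l lq]|c' c'p] := H X B p => //; last first.
  by exists c'; apply: sub_eqv => q /c'p.
have : sat (Conj l) (vjoin c (fcomp k (@fid S (subfam B)))).
  by rewrite sat_Conj => r /lq/qp.
move=> /(elementary_exists kE)[c' /BE]; rewrite vjoin_comp sat_Conj => c'l.
by exists (fcomp (substr_inc cB) c') => r /lq/c'l.
Qed.

(* A realisation [x1] of [tp(x0/A)] outside a small elementary [P0] exists by
   saturation; an automorphism over [A] taking [x1] to [x0] moves [P0] off [x0]. *)
Lemma not_acl A e : small K A -> ~ acl A e -> exists P, [/\ esub P, A `<=` P & ~ P e].
Proof.
case: e => s x0 sA ne; have [P0 [P0E AP0 sP0]] := small_esub hK sA.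
pose X := ext (@nofam S) s; pose J := join X (subfam P0).
pose f : fhom (ext (subfam A) s) J := fun t z =>
  match z with Old t x => inr (subfam_sub AP0 x) | New => inl (New _ s) end.
pose tup (y : U s) : fhom J U := vjoin (vext (@novar S U) y) (@subfam_inc S U P0).
have tupf y : fcomp (tup y) f = vext (@subfam_inc S U A) y.
  by apply: fhom_ext => t z; case: z.
pose ne_ (z : subfam P0 s) : formula L J :=
  Not (Eql (Var L (inl (New _ s) : J s)) (Var L (inr z : J s))).
pose p : set (formula L J) := [set q |
  (exists2 r, q = rename f r & sat r (vext (@subfam_inc S U A) x0)) \/ exists z, q = ne_ z].
(* A finite part of [p] follows from one formula [r] over [A] and finitely many excluded points [m].
   As [x0] is not algebraic, [r] has infinitely many solutions. *)
have fin l : (forall r, List.In r l -> p r) -> exists r (m : list (subfam P0 s)),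
    sat r (vext (@subfam_inc S U A) x0) /\ forall y, sat r (vext (@subfam_inc S U A) y) ->
    (forall z, List.In z m -> y <> sval z) -> forall q, List.In q l -> sat q (tup y).
  elim: l => [|q l IH] lp; first by exists (Not Bot), [::]; split=> [|y _ _ q []] /=.
  have [|r [m [rx0 H]]] := IH; first by move=> r rl; apply: lp; right.
  case: (lp q); first by left.
    move=> [r' -> r'x0]; exists (And r r'), m; split; first by rewrite sat_And.
    move=> y; rewrite sat_And => -[ry r'y] my q' [<-|]; last exact: H.
    by rewrite sat_rename tupf.
  move=> [z ->]; exists r, (z :: m); split=> // y ry my q' [<- /= yz|].
    by apply: (my z) => //; left.
  by apply: H => // z' z'm; apply: my; right.
have [_ sat_U _] := hU.
have [|||a ap] := sat_U X P0 p => //.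
- by apply: small_ext => //; apply: small_card_le smallN; apply/(card_le_injP _ 0);
    exists (fun=> 0) => -[? []].
- move=> q qp /finite_list[l lq]; have [|r [m [rx0 H]]] := fin l.
    by move=> r /lq/qp.
  have [y [ry my]] : exists y, sat r (vext (@subfam_inc S U A) y) /\
      forall z, List.In z m -> y <> sval z.
    apply: contrapT => ny; apply: ne; exists r => /=; split => //.
    apply: sub_finite_set (list_finite (map sval m)) => y /= ry.
    apply: contrapT => ym; apply: ny; exists y; split=> // z zm yz; apply: ym.
    by rewrite yz; exact: List.in_map.
  exists (vext (@novar S U) y) => q' /lq q'l; exact: H.
pose x1 := a s (New _ s).
have ea : vjoin a (@subfam_inc S U P0) = tup x1 by apply: fhom_ext => t [[? []|]|].
have nx1 : ~ P0 (existT U s x1).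
  move=> P0x; have : p (ne_ (exist (fun x => P0 (existT U s x)) x1 P0x)) by right; eexists.
  by move/ap; rewrite /tp /mkset ea; apply.
have : eqv (vext (@subfam_inc S U A) x0) (vext (@subfam_inc S U A) x1).
  apply: sub_eqv => r rx0; have : p (rename f r) by left; exists r.
  by move/ap; rewrite /tp /mkset ea sat_rename tupf.
move=> /eqv_sym/homogeneous[|h hA e].
  by apply: small_ext => //; exact: small_subfam.
have he t z : h t (vext (@subfam_inc S U A) x1 z) = vext (@subfam_inc S U A) x0 z.
  by rewrite -e.
exists (elmap h @` P0); split.
- by apply: esub_image => //; exact: automorphism_elementary.
- move=> [t x] Ax; apply/imageP_el; exists x; split; first exact: (AP0 _ Ax).
  exact: (he t (Old s (exist (fun x => A (existT U t x)) x Ax))).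
- have /= hx1 := he s (New _ s); move=> /imageP_el[x [P0x]]; rewrite -hx1.
  by have [[h1 _ _] _] := hA => /h1 xx1; apply: nx1; rewrite -xx1.
Qed.

(** For small [B], [acl_esub] and [not_acl] make [acl B] the intersection of the elementary sets
    containing [B]. The closure properties here and below are read off from this, without handling
    algebraic formulas. *)
Lemma acl_subset A B : small K B -> A `<=` acl B -> acl A `<=` acl B.
Proof.
move=> sB AB e Ae; apply: contrapT => /(not_acl sB)[P [PE BP]]; apply.
by apply: (acl_esub PE) Ae; apply: subset_trans AB (acl_esub PE BP).
Qed.

Lemma acl_mono A B : small K B -> A `<=` B -> acl A `<=` acl B.
Proof. by move=> sB AB; apply: acl_subset => //; apply: subset_trans AB (@sub_acl _ _ _ _). Qed.

Lemma acl_acl A : small K A -> acl (acl A) = acl A.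
Proof. by move=> sA; apply/seteqP; split; [exact: acl_subset|exact: sub_acl]. Qed.

Lemma small_acl A : small K A -> small K (acl A).
Proof.
move=> sA; have [P [PE AP sP]] := small_esub hK sA.
by apply: small_sub sP; exact: acl_esub.
Qed.

Lemma closed_acl A : small K A -> closed_subset (acl A).
Proof.
move=> sA f a Aa; apply: contrapT => /(not_acl sA)[P [PE AP]]; apply.
by have [cP _] := PE; apply: cP => j; apply: (acl_esub PE AP); exact: Aa.
Qed.

Lemma image_acl h A : small K A -> automorphism h -> elmap h @` acl A = acl (elmap h @` A).
Proof.
have sub g B : small K B -> automorphism g -> elmap g @` acl B `<=` acl (elmap g @` B).
  move=> sB gA _ [e Be <-]; apply: contrapT => /not_acl[|P [PE BP]]; first exact: small_image.
  have [g' [g'A g'g gg']] := automorphism_inv gA; apply.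
  have g'E := esub_image (automorphism_elementary g'A) PE.
  have [e' Pe' <-] : (elmap g' @` P) e.
    apply: (acl_esub g'E) Be => e' Be'; exists (elmap g e'); first by apply: BP; exists e'.
    by case: e' {Be'} => s x; rewrite /elmap /= g'g.
  by case: e' Pe' => s x; rewrite /elmap /= gg'.
move=> sA hA; apply/seteqP; split; first exact: sub.
have [g [gA gh hg]] := automorphism_inv hA.
have hgK e : elmap h (elmap g e) = e by case: e => s x; rewrite /elmap /= hg.
have ghK e : elmap g (elmap h e) = e by case: e => s x; rewrite /elmap /= gh.
move=> e he; exists (elmap g e) => //.
have -> : A = elmap g @` (elmap h @` A).
  rewrite image_comp; apply/seteqP; split=> [x Ax|_ [x Ax <-]]; last by rewrite /= ghK.
  by exists x => //=; rewrite ghK.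
by apply: (sub g (elmap h @` A)); [exact: small_image|exact: gA|exists e].
Qed.

End Monster.


(** * Reducts *)

Section Reducts.
Variables (S : Type) (L : language S) (L0 : sublanguage L).
Implicit Types (M N : structure L) (X : S -> Type).

Lemma tval_lift M X (v : fhom X M) s (t : term L0 X s) :
  tval v (lift_term t) = tval (U := reduct L0 M) v t.
Proof. by elim: t => //= f ts IH; congr fint; apply: functional_extensionality_dep. Qed.

Lemma sat_lift M X (p : formula L0 X) (v : fhom X M) :
  sat (lift_formula p) v <-> sat (U := reduct L0 M) p v.
Proof.
elim: p v => {X} [X|X s t u|X r ts|X p IHp q IHq|X s p IHp] v //=.
- by rewrite !tval_lift.
- suff -> : (fun i => tval v (lift_term (ts i))) = (fun i => tval (U := reduct L0 M) v (ts i)).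
    by [].
  by apply: functional_extensionality_dep => i; exact: tval_lift.
- by rewrite IHp IHq.
- by split=> H a; apply/IHp.
Qed.

Lemma eqv_reduct M N X (a : fhom X M) (b : fhom X N) :
  eqv a b -> eqv (M := reduct L0 M) (N := reduct L0 N) a b.
Proof. by move=> ab p; rewrite -!sat_lift. Qed.

Lemma embedding_reduct M N (h : fhom M N) :
  embedding h -> embedding (M := reduct L0 M) (N := reduct L0 N) h.
Proof.
by move=> [h1 h2 h3]; split=> // [f|r] a; [exact: (h2 (sval f))|exact: (h3 (sval r))].
Qed.

Lemma models_reduct M (T0 : theory L0) (T : theory L) :
  (forall p, T0 p -> T (lift_formula p)) -> models M T -> models (reduct L0 M) T0.
Proof. by move=> T0T HM p /T0T/HM; rewrite /holds sat_lift. Qed.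

End Reducts.

(** * Structures placed inside a structure *)

Section Placed.
Variables (S : Type) (L : language S) (L0 : sublanguage L) (U : structure L0).
Implicit Types (A B C N : lstr_in U) (h : fhom U U).

(** An automorphism of [U] need not respect [L], so the [L]-structure is kept and only its inclusion
    into [U] changes. *)
Definition move A h (hA : automorphism h) : lstr_in U :=
  LstrIn (embedding_comp hA.1 (@oincP S L L0 U A)).

Definition restrict A (P : set (el A)) (cP : closed_subset P) : lstr_in U :=
  LstrIn (embedding_comp (@oincP S L L0 U A) (embedding_reduct L0 (substr_embedding cP))).

Lemma uset_move A h (hA : automorphism h) : uset (move A hA) = elmap h @` uset A.
Proof. by rewrite /uset image_comp. Qed.

Lemma uset_restrict A (P : set (el A)) (cP : closed_subset P) :
  uset (restrict cP) = push P.
Proof.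
rewrite -[LHS]/(trange (fcomp (@oinc _ _ _ _ A) (@subfam_inc S A P))).
by rewrite trange_comp trange_inc.
Qed.

Lemma oinc_inj A s (x y : A s) : oinc x = oinc y -> x = y.
Proof. by have [H _ _] := @oincP S L L0 U A; exact: H. Qed.

Lemma subL_trans A B C : subL A B -> subL B C -> subL A C.
Proof.
move=> [f fE fo] [g gE go]; exists (fcomp g f); first exact: embedding_comp.
by move=> s x; rewrite /fcomp go fo.
Qed.

Lemma subL_restrict A (P Q : set (el A)) (cP : closed_subset P) (cQ : closed_subset Q) :
  P `<=` Q -> subL (restrict cP) (restrict cQ).
Proof.
move=> PQ; exists (subfam_sub PQ) => //.
split=> [s [x Px] [y Py] /= []|f a|r a] //; first by move=> xy; exact: eq_exist.
exact: eq_exist.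
Qed.

Lemma subL_move A B h (hA : automorphism h) :
  fixes h (uset A) -> subL A B -> subL A (move B hA).
Proof.
move=> hfix [f fE fo]; exists f => // s x; rewrite /= /fcomp fo hfix//.
by exists (existT _ s x).
Qed.

Lemma subL_move2 A B h (hA : automorphism h) : subL A B -> subL (move A hA) (move B hA).
Proof. by move=> [f fE fo]; exists f => // s x; rewrite /= /fcomp fo. Qed.

Lemma subL_sub A B : subL A B -> uset A `<=` uset B.
Proof.
by move=> [f _ fo] _ [[s x] _ <-]; exists (existT _ s (f s x)) => //; rewrite /elmap /= fo.
Qed.

(** The inclusion of sets respects [L] because its composite with the embedding of [B] into [N] is
    the embedding of [A]. *)
Lemma subL_common A B N : subL A N -> subL B N -> uset A `<=` uset B -> subL A B.
Proof.
move=> [f [f1 f2 f3] fo] [g [g1 g2 g3] go] AB.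
have ex s (x : A s) : exists y : B s, oinc y = oinc x.
  have /AB[[t y] _ e] : uset A (existT U s (oinc x)) by exists (existT _ s x).
  by apply: (el_eq (P := fun s z => exists y : B s, oinc y = z) (esym e)); exists y.
pose h : fhom A B := fun s x => projT1 (cid (ex s x)).
have ho s x : oinc (h s x) = oinc x by exact: (projT2 (cid (ex s x))).
have gh s x : g s (h s x) = f s x by apply: oinc_inj; rewrite go fo ho.
exists h => //; split=> [s x y e|k a|r a].
- by apply: oinc_inj; rewrite -!ho e.
- apply: g1; rewrite gh f2 g2; congr fint.
  by apply: functional_extensionality_dep => i; rewrite gh.
- rewrite f3 g3; suff -> : (fun i => g _ (h _ (a i))) = (fun i => f _ (a i)) by [].
  by apply: functional_extensionality_dep => i; rewrite gh.
Qed.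

Lemma subL_universal_part A B (T : theory L) :
  subL A B -> models B (universal_part T) -> models A (universal_part T).
Proof. by move=> [f fE _]; exact: embedding_universal_part fE. Qed.

Variables (T0 : theory L0) (T : theory L).
Hypotheses (mcT0 : model_complete T0) (UT0 : models U T0)
  (T0T : forall p, T0 p -> T (lift_formula p)).

(** Here the inclusion of [T0] in [T] enters: it makes the reduct of [N] a model of [T0], so that
    model completeness of [T0] applies. *)
Lemma oinc_elementary N :
  models N T -> elementary (M := reduct L0 N) (@oinc S L L0 U N).
Proof. by move=> NT; apply: mcT0 (@oincP S L L0 U N) => //; exact: models_reduct NT. Qed.

Lemma esub_uset N : models N T -> esub (uset N).
Proof. by move=> /oinc_elementary/esub_trange. Qed.

End Placed.

(** * Independence relations *)

Section Independence.
Variables (K S : Type) (L : language S) (T : theory L) (U : structure L) (R : ternary U).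
Hypotheses (hK : large_for K L) (hU : monster K T U) (iR : independence_relation K R).
Implicit Types (A B C D P : set (el U)).

Let smallN : small K [set: nat].
Proof. by case: hK. Qed.

Lemma indep_monor A B B' C : small K A -> small K B' -> small K C ->
  B `<=` B' -> R A C B' -> R A C B.
Proof.
move=> sA sB sC BB' H; have sB' := small_sub BB' sB.
by apply: (ind_monotonicity iR sC sA sB' sB); rewrite setUidr.
Qed.

Lemma indep_sym A B C : small K A -> small K B -> small K C -> R A C B -> R B C A.
Proof. by move=> sA sB sC; exact: (ind_symmetry iR sC sA sB). Qed.

Lemma indep_base A B C : small K A -> small K B -> small K C ->
  R A C B -> R (A `|` C) C B.
Proof.
move=> sA sB sC H; apply: indep_sym => //; first exact: small_setU.
by apply: (ind_normality iR) => //; exact: indep_sym.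
Qed.

(** Full existence moves [P], fixing [B] and [C], to be independent from [D] over both; transitivity
    through [B] lowers the base to [C]. *)
Lemma indep_extend P B C D : small K P -> small K C -> small K D -> B `<=` P ->
  R B C D -> exists h : fhom U U,
    [/\ automorphism h, fixes h B, fixes h C & R (elmap h @` P) C D].
Proof.
move=> sP sC sD BP H; have sB := small_sub BP sP.
have sCB : small K (C `|` B) by exact: small_setU.
have [a' e Ra'] := ind_full_existence iR (@subfam_inc S U P) (small_subfam sP) sD sCB.
have [h [hA ha hfix]] := tp_automorphism hK hU (small_subfam sP) sCB (esym e).
have hB : fixes h B by apply: fixes_sub hfix; right.
exists h; split=> //; first by apply: fixes_sub hfix; left.
have hP : trange a' = elmap h @` P by rewrite -ha trange_comp trange_inc.
rewrite hP in Ra'.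
have <- : elmap h @` P `|` B = elmap h @` P.
  by apply: setUidl; rewrite -(fixes_image hB); exact: image_subset.
by apply: (ind_transitivity iR) => //; exact: small_image.
Qed.

End Independence.


(** * Amalgamation of three structures *)

Lemma large_for_sublang (K S : Type) (L : language S) (L0 : sublanguage L) :
  large_for K L -> large_for K L0.
Proof.
have sig_le (T : Type) (P : set T) : [set: {x | P x}] #<= [set: T].
  by apply: (@inj_card_leT _ _ (fun x => sval x)) => -[x ?] [y ?] /= e; exact: eq_exist.
move=> [sN sS sf sr]; split=> //=; [apply: small_card_le sf|apply: small_card_le sr];
  exact: sig_le.
Qed.

Section Amalgamation.
Variables (K S : Type) (L : language S) (L0 : sublanguage L) (T0 : theory L0) (T : theory L)
  (U : structure L0) (R : ternary U).
Hypotheses (hK : large_for K L0) (hU : monster K T0 U) (mcT0 : model_complete T0)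
  (T0T : forall p, T0 p -> T (lift_formula p))
  (iR : independence_relation K R) (dlR : derivation_like K R T).

Let UT0 : models U T0.
Proof. by case: hU. Qed.

(* Uniqueness in the definition of derivation-like makes the structure on
   [acl (A1 A2)] the same in [N] and in [W]. *)
Lemma amalgamate_unique (A1 A2 C N W : lstr_in U) :
  models A1 (universal_part T) -> models A2 (universal_part T) ->
  subL C A1 -> subL C A2 -> small K (uset A1) -> small K (uset A2) ->
  acl (uset C) = uset C -> R (uset A1) (uset C) (uset A2) ->
  models N T -> subL A1 N -> subL A2 N ->
  models W T -> subL A1 W -> subL A2 W ->
  exists E : lstr_in U, [/\ uset E = acl (uset A1 `|` uset A2), models E (universal_part T),
    subL E N, subL E W & subL A1 E /\ subL A2 E].
Proof.
move=> mA1 mA2 CA1 CA2 sA1 sA2 aC RA mN A1N A2N mW A1W A2W.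
have mC := subL_universal_part CA1 mA1.
have sA12 : small K (uset A1 `|` uset A2) by apply: small_setU => //; case: hK.
have [|| _ uniq] := dlR mA1 mA2 mC CA1 CA2 sA1 sA2 _ _ RA.
- by rewrite aC; apply: setIidl; exact: subL_sub.
- by rewrite aC; apply: setIidl; exact: subL_sub.
pose D := acl (uset A1 `|` uset A2).
have cD : closed_subset D by exact: (closed_acl hK hU sA12).
have gD : generated (uset A1 `|` uset A2) `<=` D.
  by apply: smallest_sub => //; exact: sub_acl.
have DN (N' : lstr_in U) : models N' T -> subL A1 N' -> subL A2 N' ->
    D `<=` acl (uset A1 `|` uset A2) `&` uset N'.
  move=> mN' A1N' A2N' e De; split=> //.
  apply: (acl_esub (esub_uset mcT0 UT0 T0T mN')) De.
  by rewrite subUset; split; exact: subL_sub.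
have [E [[uE mE A1E A2E] EN uE']] := uniq N D mN A1N A2N cD gD (DN N mN A1N A2N).
have [F [[uF mF A1F A2F] FW _]] := uniq W D mW A1W A2W cD gD (DN W mW A1W A2W).
have [_ EF] := uE' F (And4 uF mF A1F A2F).
by exists E; split=> //; exact: subL_trans EF FW.
Qed.

(* [Si] is only determined up to automorphisms over [Sb] and [SAi], which leaves
   room to make the three structures independent. *)
Lemma amalgamate_three (S1 S2 W Sb SA1 SA2 SM : lstr_in U) :
  models S1 (universal_part T) -> models S2 (universal_part T) -> models W T ->
  subL Sb S1 -> subL Sb S2 -> subL SA1 S1 -> subL SA2 S2 ->
  subL SA1 W -> subL SA2 W -> subL SM SA1 -> subL SM SA2 ->
  small K (uset S1) -> small K (uset S2) -> small K (uset W) ->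
  acl (uset Sb) = uset Sb -> acl (uset SM) = uset SM -> uset SM `<=` uset Sb ->
  R (uset Sb) (uset SM) (uset W) -> R (uset SA1) (uset SM) (uset SA2) ->
  exists (N : lstr_in U) (h1 h2 : fhom U U) (h1A : automorphism h1) (h2A : automorphism h2),
    [/\ models N T, subL W N, subL (move S1 h1A) N, subL (move S2 h2A) N
      & [/\ fixes h1 (uset Sb), fixes h1 (uset SA1), fixes h2 (uset Sb)
          & fixes h2 (uset SA2)]].
Proof.
move=> mS1 mS2 mW bS1 bS2 A1S1 A2S2 A1W A2W MA1 MA2 s1 s2 sW ab aM Mb RbW RA.
have sN : small K [set: nat] by case: hK.
have sb := small_sub (subL_sub bS1) s1.
have sA1 := small_sub (subL_sub A1S1) s1.
have sA2 := small_sub (subL_sub A2S2) s2.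
have sM := small_sub Mb sb.
have mA1 := subL_universal_part A1S1 mS1.
have mA2 := subL_universal_part A2S2 mS2.
have A21W : uset SA2 `|` uset SA1 `<=` uset W by rewrite subUset; split; exact: subL_sub.
(* Monotonicity and base monotonicity make [Sb] independent from [SA2] over [SM] and [SA1];
   transitivity adds [SA1] on the left, and base monotonicity then puts [Sb] into the base. *)
have RA1b : R (uset SA1) (uset Sb) (uset SA2).
  have /(ind_base_monotonicity iR sb sA2 sM sA1) H := indep_monor iR sb sW sM A21W RbW.
  have := ind_transitivity iR sb sA1 sM sA2 H RA.
  move=> /(indep_sym iR (small_setU sN sb sA1) sA2 sM); rewrite setUC.
  move=> /(ind_base_monotonicity iR sA2 sA1 sM sb); rewrite (setUidr Mb).
  exact: (indep_sym iR sA2 sA1 sb).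
(* [S1] is first made independent from [SA2] alone; this is what allows [S2] to be moved over [SA2]
   in the next step. *)
have [h1 [h1A h1A1b _ R1]] : exists h, [/\ automorphism h,
    fixes h (uset SA1 `|` uset Sb), fixes h (uset Sb)
    & R (elmap h @` uset S1) (uset Sb) (uset SA2)].
  apply: (indep_extend hK hU iR) => //; last exact: (indep_base hK iR).
  by rewrite subUset; split; exact: subL_sub.
have s1' : small K (elmap h1 @` uset S1) by exact: small_image.
have [h2 [h2A h2A2b _ R2]] : exists h, [/\ automorphism h,
    fixes h (uset SA2 `|` uset Sb), fixes h (uset Sb)
    & R (elmap h @` uset S2) (uset Sb) (elmap h1 @` uset S1)].
  apply: (indep_extend hK hU iR) => //; last first.
    by apply: (indep_base hK iR) => //; exact: (indep_sym iR).
  by rewrite subUset; split; exact: subL_sub.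
have h1b : fixes h1 (uset Sb) by apply: fixes_sub h1A1b; right.
have h1A1 : fixes h1 (uset SA1) by apply: fixes_sub h1A1b; left.
have h2b : fixes h2 (uset Sb) by apply: fixes_sub h2A2b; right.
have h2A2 : fixes h2 (uset SA2) by apply: fixes_sub h2A2b; left.
pose S1' := move S1 h1A; pose S2' := move S2 h2A.
have us1 : uset S1' = elmap h1 @` uset S1 by exact: uset_move.
have us2 : uset S2' = elmap h2 @` uset S2 by exact: uset_move.
have s2' : small K (uset S2') by rewrite us2; exact: small_image.
rewrite -us1 in s1' R2; rewrite -us2 in R2.
have bS1' : subL Sb S1' by exact: subL_move.
have bS2' : subL Sb S2' by exact: subL_move.
have R12 := indep_sym iR s2' s1' sb R2.
have [N1 [mN1 S1N1 S2N1]] : exists N : lstr_in U, [/\ models N T, subL S1' N & subL S2' N].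
  have [||//] := dlR (A := S1') (B := S2') mS1 mS2 (subL_universal_part bS1 mS1)
    bS1' bS2' s1' s2' _ _ R12.
  - by rewrite ab; apply: setIidl; exact: subL_sub.
  - by rewrite ab; apply: setIidl; exact: subL_sub.
(* [N1] need not be small, so the last amalgamation uses its small part [E1]; here [N1] serves as
   both models of the lemma. *)
have [E1 [uE1 mE1 _ E1N1 [S1E1 S2E1]]] := amalgamate_unique (A1 := S1') (A2 := S2') mS1 mS2
  bS1' bS2' s1' s2' ab R12 mN1 S1N1 S2N1 mN1 S1N1 S2N1.
have A1N1 : subL SA1 N1 by apply: subL_trans S1N1; exact: subL_move.
have A2N1 : subL SA2 N1 by apply: subL_trans S2N1; exact: subL_move.
(* [N1] and [W] induce the same structure on the closure of [SA1] and [SA2], so [C] is a common base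
   of [E1] and [W]. *)
have [C [uC mC CN1 CW [A1C A2C]]] := amalgamate_unique mA1 mA2 MA1 MA2 sA1 sA2 aM RA
  mN1 A1N1 A2N1 mW A1W A2W.
have s12 : small K (uset S1' `|` uset S2') by exact: small_setU.
have sE1 : small K (uset E1) by rewrite uE1; exact: (small_acl hK).
have CE1 : subL C E1.
  apply: subL_common CN1 E1N1 _; rewrite uC uE1; apply: (acl_mono hK hU) => //.
  rewrite subUset; split.
    by apply: subset_trans (subL_sub (subL_move h1A h1A1 A1S1)) _; left.
  by apply: subset_trans (subL_sub (subL_move h2A h2A2 A2S2)) _; right.
have sC := small_sub (subL_sub CW) sW.
have aC : acl (uset C) = uset C.
  by rewrite uC (acl_acl hK hU)//; exact: small_setU.
have MC : uset SM `<=` uset C := subset_trans (subL_sub MA1) (subL_sub A1C).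
(* As [SM] lies in [C] and [C] in [W], base monotonicity replaces the base [SM] by [C]; then [E1]
   can be moved while [Sb] stays fixed. *)
have RbC : R (uset Sb `|` uset C) (uset C) (uset W).
  apply: (indep_base hK iR) => //.
  have := ind_base_monotonicity iR sb sW sM sC.
  by rewrite (setUidl (subL_sub CW)) (setUidr MC); apply.
have [h3 [h3A h3bC h3C R3]] : exists h, [/\ automorphism h,
    fixes h (uset Sb `|` uset C), fixes h (uset C) & R (elmap h @` uset E1) (uset C) (uset W)].
  apply: (indep_extend hK hU iR) => //.
  rewrite subUset; split; last exact: subL_sub.
  exact: subset_trans (subL_sub bS1') (subL_sub S1E1).
pose E1' := move E1 h3A.
rewrite -uset_move in R3.
have CE1' : subL C E1' by exact: subL_move.
have sE1' : small K (uset E1') by rewrite uset_move; exact: small_image.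
have [||[N [mN E1N WN]] _] := dlR (A := E1') (B := W) mE1 (models_universal_part mW) mC CE1' CW
  sE1' sW _ _ R3.
- by rewrite aC; apply: setIidl; exact: subL_sub.
- by rewrite aC; apply: setIidl; exact: subL_sub.
have h3b : fixes h3 (uset Sb) by apply: fixes_sub h3bC; left.
have h3A1 : fixes h3 (uset SA1) by apply: fixes_sub h3C; exact: subL_sub.
have h3A2 : fixes h3 (uset SA2) by apply: fixes_sub h3C; exact: subL_sub.
exists N, (fcomp h3 h1), (fcomp h3 h2), (automorphism_comp h3A h1A), (automorphism_comp h3A h2A).
split=> //; last by split; exact: fixes_comp.
- by apply: subL_trans E1N; exact: (subL_move2 h3A S1E1).
- by apply: subL_trans E1N; exact: (subL_move2 h3A S2E1).
Qed.

End Amalgamation.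


(** * From [Up] to [U0]: algebraic closure, types and substructures *)

Section Push.
Variables (K S : Type) (L : language S) (L0 : sublanguage L) (U : structure L0).
Variables (Tc : theory L) (Up : lstr_in U).
Hypotheses (hK : large_for K L) (hUp : monster K Tc Up)
  (ocE : elementary (M := reduct L0 Up) (@oinc S L L0 U Up)).

Lemma elementary_reduct (M N : structure L) (h : fhom M N) :
  elementary h -> elementary (M := reduct L0 M) (N := reduct L0 N) h.
Proof. by move=> hE X p v; have := hE X (lift_formula p) v; rewrite !sat_lift. Qed.

Lemma push_inj (P : set (el Up)) e : push P (elmap (@oinc _ _ _ _ Up) e) -> P e.
Proof. by move=> [e' Pe' /elmap_inj <-] // s x y; exact: oinc_inj. Qed.

Lemma esub_push (P : set (el Up)) : esub P -> esub (push P).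
Proof.
move=> [cP PE]; have := esub_trange (elementary_comp ocE (elementary_reduct PE)).
by rewrite trange_comp trange_inc.
Qed.

(** Elementary sets of [Up] are pushed to elementary sets of [U], so the closure of [push Q] lies in
    the image of each elementary set containing [Q]; by [not_acl] these sets intersect in [Q]. *)
Lemma acl_push (Q : set (el Up)) : small K Q -> acl Q = Q -> acl (push Q) = push Q.
Proof.
move=> sQ aQ; apply/seteqP; split; last exact: sub_acl.
move=> e ae; apply: contrapT => nQ.
have sub P : esub P -> Q `<=` P -> push P e.
  by move=> PE QP; apply: (acl_esub (esub_push PE)) ae; exact: image_subset.
have [P [PE QP _]] := small_esub hK sQ.
have [e' Pe' ee'] := sub P PE QP.
have ne' : ~ acl Q e' by rewrite aQ => Qe'; apply: nQ; exists e'.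
have [P' [P'E QP' nP'e']] := not_acl hK hUp sQ ne'.
by apply: nP'e'; apply: push_inj; rewrite ee'; exact: sub.
Qed.

(** The inclusions of [N] and [Up] into [U] are both elementary for [L0], so an equality of types
    computed in [N] and in [Up] persists in [U]. The hypothesis on [g] says that both contain the
    same copy of [B]. *)
Lemma eqv_push X (N : lstr_in U) (B : set (el Up)) (a : fhom X N) (g : fhom (subfam B) N)
    (a' : fhom X Up) :
  elementary (M := reduct L0 N) (@oinc S L L0 U N) ->
  fcomp (@oinc _ _ _ _ N) g = fcomp (@oinc _ _ _ _ Up) (@subfam_inc S Up B) ->
  eqv (M := reduct L0 N) (N := reduct L0 Up) (vjoin a g) (vjoin a' (@subfam_inc S Up B)) ->
  eqv (M := U) (N := U) (vjoin (fcomp (@oinc _ _ _ _ N) a) (@subfam_inc S U (push B)))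
    (vjoin (fcomp (@oinc _ _ _ _ Up) a') (@subfam_inc S U (push B))).
Proof.
move=> NE gB e.
have ex s (x : subfam (push B) s) : exists y : subfam B s, oinc (sval y) = sval x.
  have /imageP_el[y [By yx]] := proj2_sig x.
  by exists (exist (fun y => B (existT _ s y)) y By).
pose c : fhom (subfam (push B)) (subfam B) := fun s x => projT1 (cid (ex s x)).
have cB : fcomp (@oinc _ _ _ _ Up) (fcomp (@subfam_inc S Up B) c) = @subfam_inc S U (push B).
  by apply: fhom_ext => s x; exact: (projT2 (cid (ex s x))).
pose d : fhom (join X (subfam (push B))) (join X (subfam B)) :=
  fun s z => match z with inl x => inl x | inr y => inr (c s y) end.
have -> : vjoin (fcomp (@oinc _ _ _ _ N) a) (@subfam_inc S U (push B)) =
    fcomp (@oinc _ _ _ _ N) (fcomp (vjoin a g) d).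
  apply: fhom_ext => s [x|y] //=; rewrite -cB.
  exact: (f_equal (fun f : fhom (subfam B) U => f s (c s y)) (esym gB)).
have -> : vjoin (fcomp (@oinc _ _ _ _ Up) a') (@subfam_inc S U (push B)) =
    fcomp (@oinc _ _ _ _ Up) (fcomp (vjoin a' (@subfam_inc S Up B)) d).
  by apply: fhom_ext => s [x|y] //=; rewrite -cB.
apply: eqv_trans (eqv_trans (eqv_rename d e) (elementary_eqv _ ocE)).
exact/eqv_sym/(elementary_eqv _ NE).
Qed.

End Push.

Lemma eqv_subset (S : Type) (L : language S) (U : structure L) X (a b : fhom X U)
    (A B : set (el U)) : A `<=` B ->
  eqv (vjoin a (@subfam_inc S U B)) (vjoin b (@subfam_inc S U B)) ->
  eqv (vjoin a (@subfam_inc S U A)) (vjoin b (@subfam_inc S U A)).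
Proof.
move=> AB; pose d : fhom (join X (subfam A)) (join X (subfam B)) :=
  fun s z => match z with inl x => inl x | inr y => inr (subfam_sub AB y) end.
have e c : vjoin c (@subfam_inc S U A) = fcomp (vjoin c (@subfam_inc S U B)) d.
  by apply: fhom_ext => s [x|y].
by rewrite !e; exact: eqv_rename.
Qed.

Lemma eqv_vjoin_left (S : Type) (L : language S) (M N : structure L) (X X' Y : S -> Type)
    (f : fhom X X') (a : fhom X' M) (b : fhom X' N) (c : fhom Y M) (d : fhom Y N) :
  eqv (vjoin a c) (vjoin b d) -> eqv (vjoin (fcomp a f) c) (vjoin (fcomp b f) d).
Proof.
pose g : fhom (join X Y) (join X' Y) :=
  fun s z => match z with inl x => inl (f s x) | inr y => inr y end.
have e (U : structure L) (u : fhom X' U) (w : fhom Y U) :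
    vjoin (fcomp u f) w = fcomp (vjoin u w) g by apply: fhom_ext => s [x|y].
by rewrite !e; exact: eqv_rename.
Qed.

(** For points of [U] reached by two different moves: if [h2] after [f] agrees with [h1] on [P],
    then [f] becomes an inclusion. *)
Lemma subL_move_restrict (S : Type) (L : language S) (L0 : sublanguage L) (U : structure L0)
    (A : lstr_in U) (P Q : set (el A)) (cP : closed_subset P) (cQ : closed_subset Q)
    (f : fhom A A) (h1 h2 : fhom U U) (h1A : automorphism h1) (h2A : automorphism h2) :
  embedding f -> elmap f @` P `<=` Q ->
  (forall s (x : A s), P (existT A s x) -> h2 s (oinc (f s x)) = h1 s (oinc x)) ->
  subL (move (restrict cP) h1A) (move (restrict cQ) h2A).
Proof.
move=> [f1 f2 f3] fPQ fh.
have fQ s (x : subfam P s) : Q (existT A s (f s (sval x))).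
  by apply: fPQ; apply/imageP_el; exists (sval x); split=> //; exact: (proj2_sig x).
pose g : fhom (subfam P) (subfam Q) := fun s x => exist (fun y => Q (existT A s y)) _ (fQ s x).
exists g; last by move=> s x; exact: fh (proj2_sig x).
split=> [s [x Px] [y Py] [] /f1 xy|k a|r a]; [exact: eq_exist| |].
- by apply: eq_exist; rewrite /= f2.
- exact: (f3 r (fun i => sval (a i))).
Qed.

(** * Lifting the independence theorem from [U0] to [Up] *)

Theorem theorem3p14 (K S : Type) (L : language S) (L0 : sublanguage L)
  (T0 : theory L0) (T Tp Tc : theory L)
  (U0 : structure L0) (R0 R1 : ternary U0) (Up : lstr_in U0)
  (M : structure L) (iM : fhom M Up)
  (* the monster model U0 of T0, and the relation R0 *)
  (hK : large_for K L)
  (hT0 : deductively_closed T0) (cT0 : complete_theory T0)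
  (mcT0 : model_complete T0) (qeT0 : quantifier_elimination T0)
  (hU0 : monster K T0 U0) (invR0 : invariant K R0)
  (* T, its model companion Tp, and the monster model Up of a completion Tc *)
  (hT : deductively_closed T) (hTp : deductively_closed Tp)
  (T0T : forall p, universal_part T0 p -> T (lift_formula p))
  (dlR0 : derivation_like K R0 T)
  (mcT : model_companion T Tp) (sTTp : T `<=` Tp)
  (hTc : deductively_closed Tc) (cTc : complete_theory Tc) (sTpTc : Tp `<=` Tc)
  (hUp : monster K Tc Up)
  (* hypotheses of the theorem *)
  (hM : models M Tp) (hiM : embedding iM) (smallM : small K (trange iM))
  (sT0T : forall p, T0 p -> T (lift_formula p))
  (indR1 : independence_relation K R1)
  (R01 : forall A B : set (el U0), small K A -> small K B ->
     R0 A (push (A:=Up) (trange iM)) B ->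
     R1 A (push (A:=Up) (trange iM)) B)
  (dlR1 : derivation_like K R1 T)
  (monR0 : monotonicity_over K R0 (push (A:=Up) (trange iM)))
  (symR0 : symmetry_over K R0 (push (A:=Up) (trange iM)))
  (extR0 : extension_over K R0 (push (A:=Up) (trange iM)))
  (itR0 : independence_theorem K R0 (push (A:=Up) (trange iM))) :
  independence_theorem K (indep_plus R0 (Up:=Up)) (trange iM).
Proof.
have hK0 := large_for_sublang L0 hK.
have sN : small K [set: nat] by case: hK.
have [mcTp compl _] := mcT.
have TpT N : models N Tp -> models N T by move=> H p /sTTp/H.
have UpTp : models Up Tp by case: hUp => H _ _ p /sTpTc/H.
have UpT := TpT _ UpTp.
have U0T0 : models U0 T0 by case: hU0.
have ocE := oinc_elementary mcT0 U0T0 sT0T UpT.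
(* By model completeness of [Tp], [M] is elementary in [Up], hence algebraically closed, and the
   base of the new relation is [M] itself. *)
have iME : elementary iM by exact: mcTp.
pose Pm := trange iM.
have PmE : esub Pm by exact: esub_trange.
have aPm : acl Pm = Pm by apply/seteqP; split; [exact: acl_esub|exact: sub_acl].
have subTp (P : set (el Up)) (cP : closed_subset P) : elementary (substr_inc cP) ->
    models (substr cP) Tp.
  by move=> /elementary_models H; exact/H.
move=> X a1 a2 A1 A2 sX sA1 sA2.
rewrite /indep_plus aPm -/Pm => RA Ra1 Ra2 ea.
have sa1 : small K (trange a1 `|` Pm) by apply: small_setU => //; exact: small_trange.
have sa2 : small K (trange a2 `|` Pm) by apply: small_setU => //; exact: small_trange.
have sA1m : small K (A1 `|` Pm) by exact: small_setU.
have sA2m : small K (A2 `|` Pm) by exact: small_setU.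
pose A1b := acl (A1 `|` Pm); pose A2b := acl (A2 `|` Pm).
pose a1b := acl (trange a1 `|` Pm); pose a2b := acl (trange a2 `|` Pm).
have sA1b : small K A1b by exact: (small_acl hK).
have sA2b : small K A2b by exact: (small_acl hK).
have sa1b : small K a1b by exact: (small_acl hK).
have sa2b : small K a2b by exact: (small_acl hK).
have PmA1b : Pm `<=` A1b by move=> e ?; apply: sub_acl; right.
have PmA2b : Pm `<=` A2b by move=> e ?; apply: sub_acl; right.
have Pma1b : Pm `<=` a1b by move=> e ?; apply: sub_acl; right.
(* Equality of types over [M] gives an automorphism of [Up] taking [a1] to [a2], and so the closure
   [a1b] onto [a2b]. Through it both closures are enumerated by the same family [X1], with equal
   types over [M]. *)
have [tau [tauA ta1 taum]] := tp_automorphism hK hUp sX smallM ea.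
have tauE := automorphism_elementary tauA.
have ta1b : elmap tau @` a1b = a2b.
  rewrite /a1b (image_acl hK hUp)//; congr acl.
  by rewrite image_setU -trange_comp ta1 fixes_image.
pose X1 := subfam a1b; pose j1 : fhom X1 Up := @subfam_inc S Up a1b.
have sX1 : small K [set: el X1] by exact: small_subfam.
pose oc : fhom Up U0 := @oinc _ _ _ _ Up.
pose b1 := fcomp oc j1; pose b2 := fcomp oc (fcomp tau j1).
have b1E : trange b1 = push a1b by rewrite trange_comp trange_inc.
have b2E : trange b2 = push a2b by rewrite !trange_comp trange_inc ta1b.
have eb : tp (L := L0) (push Pm) b1 = tp (push Pm) b2.
  apply/eqv_tp; apply: (eqv_push ocE ocE) => //; apply: eqv_reduct.
  have -> : vjoin (fcomp tau j1) (@subfam_inc S Up Pm) = fcomp tau (vjoin j1 (@subfam_inc S Up Pm)).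
    by apply: fhom_ext => s [x|y] //=; rewrite /fcomp /= taum//; exact: (proj2_sig y).
  exact: elementary_eqv.
have [b0 [rb1 rb2 Rb0]] : exists b0 : fhom X1 U0,
    [/\ realises (L := L0) (tp (push Pm `|` push A1b) b1) b0,
        realises (L := L0) (tp (push Pm `|` push A2b) b2) b0
      & R0 (trange b0) (push Pm) (push A1b `|` push A2b)].
  by apply: itR0 => //; rewrite ?b1E ?b2E//; exact: small_image.
have [PW [PWE APW sPW]] : exists P : set (el Up), [/\ esub P, A1b `|` A2b `<=` P & small K P].
  by apply: (small_esub hK); exact: small_setU.
have A1bW : A1b `<=` PW by move=> e ?; apply: APW; left.
have A2bW : A2b `<=` PW by move=> e ?; apply: APW; right.
have spA1b : small K (push A1b) by exact: small_image.
have spA2b : small K (push A2b) by exact: small_image.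
have spPW : small K (push PW) by exact: small_image.
(* So far independence is only from the two closures; extension improves it to the elementary set
   [PW] and keeps the types over them. *)
have [b eb0 Rb] := extR0 X1 b0 _ _ sX1 (small_setU sN spA1b spA2b) spPW Rb0.
have pA12W : push A1b `|` push A2b `<=` push PW.
  by rewrite subUset; split; exact: image_subset.
rewrite (setUidr pA12W) in Rb.
have eb1 : eqv (vjoin b1 (@subfam_inc S U0 (push A1b))) (vjoin b (@subfam_inc S U0 (push A1b))).
  apply: eqv_trans (eqv_subset _ (realises_eqv rb1)) _; first by right.
  by apply: eqv_subset (eqv_sym (proj1 (eqv_tp _ _ _) eb0)); left; left.
have eb2 : eqv (vjoin b2 (@subfam_inc S U0 (push A2b))) (vjoin b (@subfam_inc S U0 (push A2b))).
  apply: eqv_trans (eqv_subset _ (realises_eqv rb2)) _; first by right.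
  by apply: eqv_subset (eqv_sym (proj1 (eqv_tp _ _ _) eb0)); left; right.
have [s1 [s1A s1b s1fix]] := homogeneous_over hK0 hU0 sX1 spA1b eb1.
have [s2 [s2A s2b s2fix]] := homogeneous_over hK0 hU0 sX1 spA2b eb2.

have [PM1 [PM1E aPM1 sPM1]] : exists P : set (el Up), [/\ esub P, a1b `|` A1b `<=` P & small K P].
  by apply: (small_esub hK); exact: small_setU.
have [PM2 [PM2E aPM2 sPM2]] : exists P : set (el Up), [/\ esub P, a2b `|` A2b `<=` P & small K P].
  by apply: (small_esub hK); exact: small_setU.
have a1M1 : a1b `<=` PM1 by move=> e ?; apply: aPM1; left.
have A1M1 : A1b `<=` PM1 by move=> e ?; apply: aPM1; right.
have a2M2 : a2b `<=` PM2 by move=> e ?; apply: aPM2; left.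
have A2M2 : A2b `<=` PM2 by move=> e ?; apply: aPM2; right.
have [[cW WE] [c1 E1] [c2 E2] [cm _]] := And4 PWE PM1E PM2E PmE.
have cA1 : closed_subset A1b by exact: (closed_acl hK hUp).
have cA2 : closed_subset A2b by exact: (closed_acl hK hUp).
have ca1 : closed_subset a1b by exact: (closed_acl hK hUp).
pose S1 := move (restrict c1) s1A; pose S2 := move (restrict c2) s2A.
pose W := restrict cW; pose Sb := move (restrict ca1) s1A.
pose SA1 := restrict cA1; pose SA2 := restrict cA2; pose SM := restrict cm.
have bE : uset Sb = trange b by rewrite uset_move uset_restrict -b1E -trange_comp s1b.
have s1A1 : fixes s1 (uset SA1) by rewrite uset_restrict.
have s2A2 : fixes s2 (uset SA2) by rewrite uset_restrict.
have mS1 : models S1 Tp by exact: subTp E1.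
have mS2 : models S2 Tp by exact: subTp E2.
have mW : models W Tp by exact: subTp WE.
have bS1 : subL Sb S1 by apply: subL_move2; exact: subL_restrict.
(* The structure on [b] was transported from [a1b] by [s1]. Since [tau] respects [L], the one
   transported from [a2b] by [s2] is the same. *)
have bS2 : subL Sb S2.
  apply: (@subL_move_restrict S L L0 U0 Up a1b PM2 ca1 c2 tau s1 s2 s1A s2A); first by case: tauA.
    by rewrite ta1b.
  move=> s x ax.
  have e12 : fcomp s2 b2 = fcomp s1 b1 by rewrite s1b s2b.
  exact: (f_equal (fun f : fhom X1 U0 => f s (exist (fun x => a1b (existT Up s x)) x ax)) e12).
have A1S1 : subL SA1 S1 by apply: subL_move => //; exact: subL_restrict.
have A2S2 : subL SA2 S2 by apply: subL_move => //; exact: subL_restrict.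
have A1W : subL SA1 W by exact: subL_restrict.
have A2W : subL SA2 W by exact: subL_restrict.
have MA1 : subL SM SA1 by exact: subL_restrict.
have MA2 : subL SM SA2 by exact: subL_restrict.
have sS1 : small K (uset S1) by rewrite uset_move uset_restrict; do 2!apply: small_image.
have sS2 : small K (uset S2) by rewrite uset_move uset_restrict; do 2!apply: small_image.
have sW : small K (uset W) by rewrite uset_restrict.
have ab : acl (uset Sb) = uset Sb.
  rewrite uset_move uset_restrict -(image_acl hK0 hU0)//; last exact: small_image.
  by rewrite (acl_push hK hUp)//; exact: (acl_acl hK hUp).
have aM : acl (uset SM) = uset SM by rewrite uset_restrict (acl_push hK hUp).
have Mb : uset SM `<=` uset Sb.
  rewrite uset_move !uset_restrict.
  have s1m : fixes s1 (push Pm) by apply: fixes_sub s1fix; exact: image_subset.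
  by rewrite -(fixes_image s1m); apply: image_subset; exact: image_subset.
have sb : small K (trange b) by exact: small_trange.
have RbW : R1 (uset Sb) (uset SM) (uset W).
  by rewrite bE !uset_restrict; apply: R01.
have RA12 : R1 (uset SA1) (uset SM) (uset SA2) by rewrite !uset_restrict; apply: R01.
have [N [h1 [h2 [h1A [h2A [mN [g12 g12E g12o] [g1 g1E g1o] [g2 g2E g2o]
    [h1b h1A1 h2b h2A2]]]]]]] := amalgamate_three hK0 hU0 mcT0 sT0T indR1 dlR1
  (models_universal_part (TpT _ mS1)) (models_universal_part (TpT _ mS2)) (TpT _ mW)
  bS1 bS2 A1S1 A2S2 A1W A2W MA1 MA2 sS1 sS2 sW ab aM Mb RbW RA12.
(* [N] is only a model of [T]. In a model [Np] of [Tp] around it, the images of [W], [S1] and [S2]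
   are elementary, as these are models of [Tp]. *)
have [Np [k [mNp kE]]] := compl N mN.
have kgE (Q : structure L) (g : fhom Q N) : models Q Tp -> embedding g -> elementary (fcomp k g).
  by move=> mQ gE; apply: mcTp => //; exact: embedding_comp.
(* The tuple [b] as an element of [N], read through [S1]; its place in [U0] is unchanged because
   [h1] fixes [Sb]. *)
pose beta : fhom X1 N := fun s x => g1 s (subfam_sub a1M1 x).
have betab : fcomp (@oinc _ _ _ _ N) beta = b.
  apply: fhom_ext => s x; rewrite /fcomp g1o -s1b /= /fcomp h1b//.
  by rewrite bE -s1b; exists (existT _ s x).
(* [Np] is an elementary extension of [W], so saturation of [Up] realises the type over [PW] of the
   image of [b]. *)
have [b' b'E] := saturated_realize hUp (k := fcomp k (g12 : fhom (substr cW) N)) (fcomp k beta)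
  WE (kgE _ _ mW g12E) sX1 sPW.
(* Both types over [B] are read off in [Np], where [P] and [PW] are elementary. *)
have chain (P B : set (el Up)) (cP : closed_subset P) (g : fhom (substr cP) N)
    (c : fhom X1 (subfam P)) (BP : B `<=` P) (BW : B `<=` PW) :
    elementary (substr_inc cP) -> embedding g ->
    (forall s x, oinc (g s (c s x)) = b s x) ->
    (forall s (x : subfam B s), oinc (g s (subfam_sub BP x)) = oinc (sval x)) ->
    eqv (vjoin (fcomp (@subfam_inc S Up P) c) (@subfam_inc S Up B))
        (vjoin b' (@subfam_inc S Up B)).
  move=> PE gE gc gB.
  pose w : fhom (join X1 (subfam B)) (substr cP) := vjoin c (subfam_sub BP).
  pose d : fhom (join X1 (subfam B)) (join X1 (subfam PW)) :=
    fun s z => match z with inl x => inl x | inr y => inr (subfam_sub BW y) end.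
  have -> : vjoin (fcomp (@subfam_inc S Up P) c) (@subfam_inc S Up B) = fcomp (substr_inc cP) w.
    by apply: fhom_ext => s [x|y].
  have -> : vjoin b' (@subfam_inc S Up B) = fcomp (vjoin b' (@subfam_inc S Up PW)) d.
    by apply: fhom_ext => s [x|y].
  apply: eqv_trans (eqv_sym (elementary_eqv _ PE)) _.
  apply: eqv_trans (elementary_eqv _ (kgE _ _ (subTp _ _ PE) gE)) _.
  apply: eqv_trans (eqv_rename d b'E).
  suff -> : fcomp (fcomp k g) w =
      fcomp (vjoin (fcomp k beta) (fcomp k (g12 : fhom (substr cW) N))) d.
    by [].
  apply: fhom_ext => s [x|y] /=; rewrite /fcomp /=; congr (k s _); apply: oinc_inj.
    by rewrite gc -betab.
  by rewrite gB g12o.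
have inA1 s (x : subfam A1b s) : push A1b (existT U0 s (oinc (sval x))).
  by exists (existT _ s (sval x)) => //; exact: (proj2_sig x).
have inA2 s (x : subfam A2b s) : push A2b (existT U0 s (oinc (sval x))).
  by exists (existT _ s (sval x)) => //; exact: (proj2_sig x).
rewrite uset_restrict in h1A1; rewrite uset_restrict in h2A2.
have e1 : eqv (vjoin j1 (@subfam_inc S Up A1b)) (vjoin b' (@subfam_inc S Up A1b)).
  apply: (chain PM1 A1b c1 g1 (subfam_sub a1M1) A1M1 A1bW E1 g1E) => s x.
    by rewrite -betab.
  by rewrite g1o /= /fcomp /= s1fix ?h1A1//; exact: inA1.
have ta s (x : X1 s) : PM2 (existT Up s (tau s (sval x))).
  apply: a2M2; rewrite -ta1b; apply/imageP_el; exists (sval x); split=> //.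
  exact: (proj2_sig x).
(* Over [A2b] the same tuple is read through [S2], as the image of [tau] applied to [a1b], which
   [s2] carries to [b]. *)
have e2 : eqv (vjoin (fcomp tau j1) (@subfam_inc S Up A2b)) (vjoin b' (@subfam_inc S Up A2b)).
  apply: (chain PM2 A2b c2 g2 (fun s x => exist (fun y => PM2 (existT Up s y)) _ (ta s x))
    A2M2 A2bW E2 g2E) => s x.
    rewrite g2o; have /= e := f_equal (fun f : fhom X1 U0 => f s x) s2b.
    rewrite /fcomp /= [s2 s _]e h2b//.
    by rewrite bE; exists (existT _ s x).
  by rewrite g2o /= /fcomp /= s2fix ?h2A2//; exact: inA2.
have ia s (x : X s) : a1b (existT Up s (a1 s x)).
  by apply: sub_acl; left; exists (existT _ s x).
(* [b'] enumerates a whole closure; [iota] selects the entries that correspond to [a1]. *)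
pose iota : fhom X X1 := fun s x => exist (fun y => a1b (existT Up s y)) _ (ia s x).
have BA1 : Pm `|` A1 `<=` A1b by rewrite setUC; exact: sub_acl.
have BA2 : Pm `|` A2 `<=` A2b by rewrite setUC; exact: sub_acl.
exists (fcomp b' iota); split.
- by move=> q; have := eqv_vjoin_left iota (eqv_subset BA1 e1) => /(_ q)[+ _].
- move=> q; have := eqv_vjoin_left iota (eqv_subset BA2 e2) => /(_ q)[+ _].
  by rewrite (_ : fcomp (fcomp tau j1) iota = a2)// -ta1.
(* [b'] has the type of [a1b] over [M], so by an automorphism its range is the closure of the
   selected entries over [M]. *)
have [th [thA thb thm]] := homogeneous_over hK hUp sX1 smallM (eqv_subset PmA1b e1).
have -> : acl (trange (fcomp b' iota) `|` Pm) = trange b'.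
  have -> : trange b' = elmap th @` a1b by rewrite -thb trange_comp trange_inc.
  rewrite (image_acl hK hUp)//; congr acl.
  by rewrite image_setU -trange_comp (fixes_image thm) -thb.
(* Independence remains. Over [PW], [b'] has the same [L0]-type as [beta]; hence an automorphism
   [eta] of [U0] fixing [push PW] carries [b] to the image of [b'], and invariance applies to
   [Rb]. *)
have eN : eqv (M := reduct L0 N) (N := reduct L0 Up) (vjoin beta (g12 : fhom (subfam PW) N))
    (vjoin b' (@subfam_inc S Up PW)).
  have kL0 : elementary (M := reduct L0 N) (N := reduct L0 Np) k.
    apply: mcT0; [exact: models_reduct mN|exact: models_reduct (TpT _ mNp)|].
    exact: embedding_reduct.
  apply: eqv_trans (elementary_eqv _ kL0) _; rewrite vjoin_comp.
  exact: eqv_reduct b'E.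
have := eqv_push ocE (oinc_elementary mcT0 U0T0 sT0T mN) _ eN.
rewrite betab => /(_ _)/(homogeneous_over hK0 hU0 sX1 spPW)[|eta [etaA etab etafix]].
  by apply: fhom_ext => s x; exact: g12o.
have smW : push Pm `<=` push PW.
  by apply: image_subset; exact: subset_trans PmA1b A1bW.
have spPm : small K (push Pm) by exact: small_image.
have := (invR0 eta _ _ _ etaA sb spPW spPm).1 Rb.
rewrite -trange_comp etab (fixes_image (fixes_sub smW etafix)) (fixes_image etafix) trange_comp.
have sA12 : small K ((A1 `|` A2) `|` Pm) by do 2!apply: small_setU => //.
(* [PW] is elementary and contains [A1], [A2] and [M], hence their closure, so monotonicity
   finishes. *)
have AW : acl ((A1 `|` A2) `|` Pm) `<=` PW.
  apply: acl_esub => //; rewrite !subUset; split; last exact: subset_trans PmA1b A1bW.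
  by split; [apply: subset_trans A1bW|apply: subset_trans A2bW] => e ?; apply: sub_acl; left.
have pAW : push (acl ((A1 `|` A2) `|` Pm)) `<=` push PW by exact: image_subset.
rewrite -{1}(setUidr pAW); apply: monR0 => //.
- by apply: small_image; exact: small_trange.
- exact: small_sub pAW spPW.
Qed.
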